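(* Let $((A,A^* ),\mu,\gamma)$ be a Lie bialgebroid, let $\varepsilon_1,\varepsilon_2,\varepsilon_3\in\{1,-1\}$, let $\omega_1,\omega_2,\omega_3$ be $2$-forms on $A$ and $\pi_1,\pi_2,\pi_3$ bivectors on $A$, and let $$\mathcal{S}_i=\begin{pmatrix}0&\varepsilon_i\,\pi_i^{\sharp}\\ \omega_i^{\flat}&0\end{pmatrix}:A\oplus A^*\to A\oplus A^*,\qquad i=1,2,3 .$$ The following assertions are equivalent: (i) $(\mathcal{S}_1,\mathcal{S}_2,\mathcal{S}_3)$ is an $\boldsymbol{\varepsilon}$-hypersymplectic structure on the Courant algebroid $(A\oplus A^*,\mu+\gamma)$; (ii) $(\omega_1,\omega_2,\omega_3)$ is an $\boldsymbol{\varepsilon}$-hypersymplectic structure on the Lie algebroid $(A,\mu)$, $(\pi_1,\pi_2,\pi_3)$ is an $\boldsymbol{\varepsilon}$-hypersymplectic structure on the Lie algebroid $(A^*,\gamma)$, and $\pi_i$ is the inverse of $\omega_i$, $i=1,2,3$.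
   Context: $A\to M$ is a real vector bundle; $\mu$ denotes a Lie algebroid structure on $A$ (anchor $\rho_A$, bracket $[\cdot,\cdot]_A$, differential $\mathrm{d}$, Lie derivative $\mathcal{L}$) and $\gamma$ a Lie algebroid structure on $A^*$ (anchor $\rho_{A^*}$, bracket $[\cdot,\cdot]_{A^*}$, differential $\mathrm{d}_*$, Lie derivative $\mathcal{L}^*$), which together form a Lie bialgebroid. For $\omega\in\Gamma(\wedge^2A^* )$ and $\pi\in\Gamma(\wedge^2A)$, $\omega^\flat:A\to A^*$, $\langle\omega^\flat X,Y\rangle=\omega(X,Y)$, and $\pi^\sharp:A^*\to A$, $\langle\beta,\pi^\sharp\alpha\rangle=\pi(\alpha,\beta)$; $\pi$ is the inverse of $\omega$ if $\pi^\sharp\circ\omega^\flat=\mathrm{id}_A$. A symplectic form on a Lie algebroid is a non-degenerate $2$-form closed for the Lie algebroid differential. Indices are in $\mathbb{Z}_3=\{1,2,3\}$ and $\boldsymbol{\varepsilon}=(\varepsilon_1,\varepsilon_2,\varepsilon_3)$. An $\boldsymbol{\varepsilon}$-hypersymplectic structure on a Lie algebroid $(A,\mu)$ is a triplet $(\omega_1,\omega_2,\omega_3)$ of symplectic forms with inverse (Poisson) bivectors $(\pi_1,\pi_2,\pi_3)$ such that $N_i:=\pi_{i-1}^\sharp\circ\omega_{i+1}^\flat$ satisfies $N_i^2=\varepsilon_i\,\mathrm{id}_A$, $i=1,2,3$. The same definition is applied to $(A^*,\gamma)$, where, by $A=(A^* )^*$, a bivector $\pi_i$ on $A$ is viewed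 as a $2$-form on $A^*$ (and its inverse $\omega_i$ as a bivector on $A^*$). $A\oplus A^*$ carries $\langle X+\alpha,Y+\beta\rangle=\alpha(Y)+\beta(X)$. The Courant structure $\mu+\gamma$ (the double of the Lie bialgebroid) has anchor $\rho(X+\alpha)=\rho_A(X)+\rho_{A^*}(\alpha)$ and Dorfman bracket $[X+\alpha,Y+\beta]=\big([X,Y]_A+\mathcal{L}^*_\alpha Y-i_\beta\mathrm{d}_*X\big)+\big([\alpha,\beta]_{A^*}+\mathcal{L}_X\beta-i_Y\mathrm{d}\alpha\big)$. On a (pre-)Courant algebroid $(E,\langle\cdot,\cdot\rangle,\Theta)$, $\Theta=(\rho,[\cdot,\cdot])$, the deformation by a bundle endomorphism $\mathcal{I}$ of $E$ is $\Theta_{\mathcal{I}}=(\rho\circ\mathcal{I},[\cdot,\cdot]_{\mathcal{I}})$ with $[e,e']_{\mathcal{I}}=[\mathcal{I}e,e']+[e,\mathcal{I}e']-\mathcal{I}[e,e']$, and $\Theta_{\mathcal{I},\mathcal{J}}=(\Theta_{\mathcal{I}})_{\mathcal{J}}$; $c\Theta=(c\rho,c[\cdot,\cdot])$. An $\boldsymbol{\varepsilon}$-hypersymplectic structure on $(E,\Theta)$ is a triplet $(\mathcal{S}_1,\mathcal{S}_2,\mathcal{S}_3)$ of endomorphisms, skew-symmetric with respect to $\langle\cdot,\cdot\rangle$, such that $\mathcal{S}_i^2=\varepsilon_i\,\mathrm{id}_E$; $\mathcal{S}_i\mathcal{S}_j=\varepsilon_1\varepsilon_2\varepsilon_3\,\mathcal{S}_j\mathcal{S}_i$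 for $i\neq j$; and $\Theta_{\mathcal{S}_i,\mathcal{S}_i}=\varepsilon_i\Theta$, for $i,j\in\{1,2,3\}$. *)

(* Defs.v *)
From HB Require Import structures.
From mathcomp Require Import all_boot all_order all_algebra.
From mathcomp Require Import all_classical all_reals all_analysis.

Set Implicit Arguments.
Unset Strict Implicit.
Unset Printing Implicit Defensive.

Import Order.TTheory GRing.Theory Num.Theory.
Import numFieldNormedType.Exports.

Local Open Scope classical_set_scope.
Local Open Scope ring_scope.

(* Real functions of class C^k on an open subset [U] of R^n: the partial
   derivatives of order at most k exist and are continuous at every point of
   [U].  Only used for open [U]; the values outside [U] are irrelevant. *)
Fixpoint Ck_on (R : realType) (n k : nat) (U : set 'rV[R]_n)
    (f : 'rV[R]_n -> R) : Prop :=
  (forall y, U y -> {for y, continuous f}) /\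
  match k with
  | 0%N => True
  | k'.+1 => forall j : 'I_n,
      (forall y, U y -> derivable f y (delta_mx 0 j)) /\
      Ck_on k' U (fun y => 'D_(delta_mx 0 j) f y)
  end.

Definition Cinfty_on (R : realType) (n : nat) (U : set 'rV[R]_n)
  (f : 'rV[R]_n -> R) : Prop := forall k, Ck_on k U f.

Record manifold (R : realType) (n : nat) := Manifold {
  points :> topologicalType;
  mfd_hausdorff : hausdorff_space points;
  mfd_second_countable : @second_countable points;
  chart_idx : Type;
  chart_dom : chart_idx -> set points;
  chart : chart_idx -> points -> 'rV[R]_n;
  chart_inv : chart_idx -> 'rV[R]_n -> points;
  chart_cover : forall x, exists a, chart_dom a x;
  chart_dom_open : forall a, open (chart_dom a);
  chart_img_open : forall a, open (chart a @` chart_dom a);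
  chartK : forall a x, chart_dom a x -> chart_inv a (chart a x) = x;
  chart_continuous : forall a x, chart_dom a x ->
    {for x, continuous (chart a)};
  chart_inv_continuous : forall a y, (chart a @` chart_dom a) y ->
    {for y, continuous (chart_inv a)};
  chart_smooth : forall a b (j : 'I_n),
    Cinfty_on (chart a @` (chart_dom a `&` chart_dom b))
              (fun y => chart b (chart_inv a y) 0 j) }.

(* Only used for open [W]. *)
Definition smooth_on (R : realType) (n : nat) (M : manifold R n) (W : set M)
    (f : M -> R) : Prop :=
  forall a : chart_idx M,
    Cinfty_on (@chart _ _ M a @` (chart_dom a `&` W))
              (fun y => f (chart_inv a y)).

Definition smooth (R : realType) (n : nat) (M : manifold R n) (f : M -> R) :=
  smooth_on [set: M] f.

(* Tangent vectors at [x], as point derivations of the algebra of smooth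
   functions; the values at non-smooth functions are irrelevant. *)
Definition tangent_vector (R : realType) (n : nat) (M : manifold R n) (x : M)
    (D : (M -> R) -> R) : Prop :=
  (forall (c : R) f g, smooth f -> smooth g ->
     D (fun y => c * f y + g y) = c * D f + D g) /\
  (forall f g, smooth f -> smooth g ->
     D (fun y => f y * g y) = D f * g x + f x * D g).

(* A vector bundle of rank [r], given by its fibres and local trivialisations.
   A trivialisation over [triv_dom i] is recorded as the corresponding local
   frame; [frame_smooth] says that the transition matrices are smooth. *)
Record vbundle (R : realType) (n : nat) (M : manifold R n) (r : nat) :=
  VBundle {
  fiber :> M -> vectType R;
  triv_idx : Type;
  triv_dom : triv_idx -> set M;
  frame : triv_idx -> forall x, r.-tuple (fiber x);
  triv_cover : forall x, exists i, triv_dom i x;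
  triv_dom_open : forall i, open (triv_dom i);
  frame_basis : forall i x, triv_dom i x -> basis_of fullv (frame i x);
  frame_smooth : forall i j (k l : 'I_r),
    smooth_on (triv_dom i `&` triv_dom j)
              (fun x => coord (frame j x) k (frame i x)`_l) }.

Arguments triv_idx {R n M r} v.
Arguments triv_dom {R n M r} v i.
Arguments frame {R n M r} v i x.

(* Arbitrary (not necessarily smooth) sections. *)
Definition section (R : realType) (n : nat) (M : manifold R n) (r : nat)
  (A : vbundle M r) : Type := forall x : M, A x.

Definition smooth_section (R : realType) (n : nat) (M : manifold R n) (r : nat)
    (A : vbundle M r) (s : section A) : Prop :=
  forall (i : triv_idx A) (k : 'I_r),
    smooth_on (triv_dom A i) (fun x => coord (frame A i x) k (s x)).

Definition smooth_endo (R : realType) (n : nat) (M : manifold R n) (r : nat)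
    (A : vbundle M r) (S : forall x : M, 'End(A x)) : Prop :=
  forall (i : triv_idx A) (k l : 'I_r),
    smooth_on (triv_dom A i)
              (fun x => coord (frame A i x) k (S x (frame A i x)`_l)).

Lemma Ck_on_ext (R : realType) (n k : nat) (U : set 'rV[R]_n)
    (f g : 'rV[R]_n -> R) : open U -> (forall y, U y -> f y = g y) ->
  Ck_on k U f -> Ck_on k U g.
Proof.
move=> oU; have near_eq (p q : 'rV[R]_n -> R) y :
    (forall z, U z -> p z = q z) -> U y -> \forall z \near y, p z = q z.
  move=> pq Uy; have nU : nbhs y U by exact: open_nbhs_nbhs.
  by apply: filterS nU => z; exact: pq.
have cts (p q : 'rV[R]_n -> R) y : (forall z, U z -> p z = q z) -> U y ->
    {for y, continuous p} -> {for y, continuous q}.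
  move=> pq Uy cp; rewrite /prop_for /continuous_at -(pq _ Uy).
  exact: cvg_trans (near_eq_cvg (near_eq _ _ _ pq Uy)) cp.
elim: k f g => [|k IH] f g fg /= [cf df].
  by split=> // y Uy; exact: cts fg Uy (cf y Uy).
split=> [y Uy|j]; first exact: cts fg Uy (cf y Uy).
have [dfj Cfj] := df j; split=> [y Uy|].
  by apply: (near_eq_derivable (near_eq _ _ _ fg Uy)); exact: dfj.
apply: IH Cfj => y Uy.
by apply: near_eq_derive; exact: near_eq Uy.
Qed.

Lemma Ck_on_sub (R : realType) (n k : nat) (U V : set 'rV[R]_n)
    (f : 'rV[R]_n -> R) : V `<=` U -> Ck_on k U f -> Ck_on k V f.
Proof.
move=> VU; elim: k f => [|k IH] f /= [cf df].
  by split=> // y /VU /cf.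
split=> [y /VU /cf //|j]; have [dfj Cfj] := df j.
by split=> [y /VU /dfj //|]; apply: IH.
Qed.

Lemma Ck_on_cst (R : realType) (n k : nat) (U : set 'rV[R]_n) (c : R) :
  Ck_on k U (fun=> c).
Proof.
elim: k c => [|k IH] c /=; first by split=> // y _; exact: cst_continuous.
split=> [y _|j]; first exact: cst_continuous.
split=> [y _|]; first exact: derivable_cst.
have -> : (fun y : 'rV[R]_n => 'D_(delta_mx 0 j) (fun=> c) y) = fun=> 0.
  by apply/funext => y; exact: derive_cst.
exact: IH.
Qed.

Section SmoothOn.
Context (R : realType) (n : nat) (M : manifold R n).
Implicit Types (W V : set M) (f g : M -> R).

Lemma chart_img_openI (a : chart_idx M) W : open W ->
  open (chart a @` (chart_dom a `&` W)).
Proof.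
move=> oW; rewrite openE => _ [x [ax Wx] <-]; rewrite /interior.
have img : (chart a @` chart_dom a) (chart a x) by exists x.
have nW : \forall y \near chart a x, W (chart_inv a y).
  apply: (chart_inv_continuous img); rewrite chartK //.
  exact: open_nbhs_nbhs.
have nI : \forall y \near chart a x, (chart a @` chart_dom a) y.
  by apply: open_nbhs_nbhs; split=> //; exact: chart_img_open.
near=> y.
have [z az zy] : (chart a @` chart_dom a) y by near: y.
exists z => //; split=> //; rewrite -(chartK az) zy; near: y; exact: nW.
Unshelve. all: by end_near. Qed.

Lemma smooth_on_ext W f g : open W -> (forall x, W x -> f x = g x) ->
  smooth_on W f -> smooth_on W g.
Proof.
move=> oW fg sf a k; apply: Ck_on_ext (sf a k); first exact: chart_img_openI.
by move=> _ [x [ax Wx] <-]; rewrite chartK // fg.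
Qed.

Lemma smooth_on_sub W V f : V `<=` W -> smooth_on W f -> smooth_on V f.
Proof.
by move=> VW sf a k; apply: Ck_on_sub (sf a k); apply: image_subset => x [? /VW].
Qed.

Lemma smooth_on_cst W (c : R) : smooth_on W (fun=> c).
Proof. by move=> a k; exact: Ck_on_cst. Qed.

End SmoothOn.

Section Frames.
Context (R : realType).

Definition dual_frame (V : vectType R) (r : nat) (X : r.-tuple V) :
    r.-tuple 'Hom(V, R^o) :=
  [tuple (linfun (coord X k : V -> R^o) : 'Hom(V, R^o)) | k < r].

Lemma dual_frameE (V : vectType R) (r : nat) (X : r.-tuple V) (k : 'I_r) v :
  (dual_frame X)`_k v = coord X k v.
Proof. by rewrite -tnth_nth tnth_mktuple lfunE. Qed.

Lemma dual_frame_basis (V : vectType R) (r : nat) (X : r.-tuple V) :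
  basis_of fullv X -> basis_of fullv (dual_frame X).
Proof.
move=> bX; rewrite basisEfree subvf size_tuple; apply/andP; split; last first.
  rewrite /= dimvf /dim /= -(size_basis bX) dimvf.
  by rewrite [X in (_ * X)%N](_ : _ = 1%N) // muln1.
apply/freeP => c c0 i; have /lfunP/(_ X`_i) := c0.
rewrite sum_lfunE zero_lfunE (bigD1 i) //= big1 => [|j ji].
  by rewrite addr0 scale_lfunE dual_frameE coord_free ?(basis_free bX) // eqxx /GRing.scale /= mulr1.
by rewrite scale_lfunE dual_frameE coord_free ?(basis_free bX) // eq_sym (negPf ji) scaler0.
Qed.

Lemma coord_dual_frame (V : vectType R) (r : nat) (X : r.-tuple V) (k : 'I_r)
    (a : 'Hom(V, R^o)) :
  basis_of fullv X -> coord (dual_frame X) k a = a X`_k.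
Proof.
move=> bX; have bD := dual_frame_basis bX.
rewrite [in RHS](coord_basis bD (memvf a)) sum_lfunE (bigD1 k) //= big1 => [|j jk].
  by rewrite addr0 scale_lfunE dual_frameE coord_free ?(basis_free bX) // eqxx /GRing.scale /= mulr1.
by rewrite scale_lfunE dual_frameE coord_free ?(basis_free bX) // eq_sym (negPf jk) scaler0.
Qed.

Definition sum_frame (V W : vectType R) (r s : nat) (X : r.-tuple V)
    (Y : s.-tuple W) : (r + s).-tuple (V * W)%type :=
  [tuple of [seq (v, 0) | v <- X] ++ [seq (0, w) | w <- Y]].

Section Sum.
Context (V W : vectType R) (r s : nat) (X : r.-tuple V) (Y : s.-tuple W).

Lemma sum_frame_l (k : 'I_r) : (sum_frame X Y)`_(lshift s k) = (X`_k, 0).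
Proof. by rewrite nth_cat size_map size_tuple /= ltn_ord (nth_map 0) ?size_tuple. Qed.

Lemma sum_frame_r (k : 'I_s) : (sum_frame X Y)`_(rshift r k) = (0, Y`_k).
Proof.
rewrite nth_cat size_map size_tuple ltnNge leq_addr /= addKn.
by rewrite (nth_map 0) ?size_tuple.
Qed.

Lemma sum_frame_comb (c : 'I_(r + s) -> R) :
  \sum_i c i *: (sum_frame X Y)`_i =
  (\sum_k c (lshift s k) *: X`_k, \sum_k c (rshift r k) *: Y`_k).
Proof.
rewrite big_split_ord /=.
have sum_pair (m : nat) (F : 'I_m -> V) (G : 'I_m -> W) :
    \sum_i ((F i, G i) : V * W) = (\sum_i F i, \sum_i G i).
  by elim/big_rec3: _ => // i v w u _ ->.
under eq_bigr => k _ do rewrite sum_frame_l -[_ *: _]/(_ *: _, _ *: _) scaler0.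
under [X in _ + X]eq_bigr => k _ do
  rewrite sum_frame_r -[_ *: _]/(_ *: _, _ *: _) scaler0.
rewrite !sum_pair -[LHS]/(_ + _, _ + _) /= (big1 _ _ (fun=> 0 : V)) //.
by rewrite (big1 _ _ (fun=> 0 : W)) // addr0 add0r.
Qed.

Context (bX : basis_of fullv X) (bY : basis_of fullv Y).

Lemma sum_frame_basis : basis_of fullv (sum_frame X Y).
Proof.
rewrite basisEfree subvf size_tuple dimvf /dim /=.
have -> : (dim V + dim W = r + s)%N.
  by rewrite -!dimvf (size_basis bX) (size_basis bY).
rewrite leqnn !andbT; apply/freeP => c; rewrite sum_frame_comb => -[cX cY] i.
case: (split_ordP i) => k ->.
  by have /freeP fX := basis_free bX; exact: (fX (fun k => c (lshift s k))).
by have /freeP fY := basis_free bY; exact: (fY (fun k => c (rshift r k))).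
Qed.

Lemma coord_sum_frame (u : V * W) (k : 'I_(r + s)) :
  coord (sum_frame X Y) k u =
  match fintype.split k with inl i => coord X i u.1 | inr j => coord Y j u.2 end.
Proof.
pose c (k : 'I_(r + s)) := match fintype.split k with
  inl i => coord X i u.1 | inr j => coord Y j u.2 end.
rewrite -/(c k) -[RHS](coord_sum_free c k (basis_free sum_frame_basis)).
congr coord; rewrite sum_frame_comb [LHS]surjective_pairing; congr pair.
  rewrite {1}(coord_basis bX (memvf u.1)).
  by apply: eq_bigr => i _; rewrite /c (unsplitK (inl i)).
rewrite {1}(coord_basis bY (memvf u.2)).
by apply: eq_bigr => i _; rewrite /c (unsplitK (inr i)).
Qed.

End Sum.
End Frames.

Section Bundles.
Context (R : realType) (n : nat) (M : manifold R n).

Lemma dual_frame_smooth (r : nat) (A : vbundle M r) (i j : triv_idx A)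
    (k l : 'I_r) :
  smooth_on (triv_dom A i `&` triv_dom A j)
    (fun x => coord (dual_frame (frame A j x)) k (dual_frame (frame A i x))`_l).
Proof.
apply: (@smooth_on_ext _ _ _ _ (fun x => coord (frame A i x) l (frame A j x)`_k)).
- by apply: openI; exact: triv_dom_open.
- by move=> x [ix jx]; rewrite coord_dual_frame ?dual_frameE //; exact: frame_basis jx.
- by rewrite setIC; exact: frame_smooth.
Qed.

Definition dual (r : nat) (A : vbundle M r) : vbundle M r :=
  @VBundle R n M r (fun x => 'Hom(A x, R^o)) (triv_idx A) (triv_dom A)
    (fun i x => dual_frame (frame A i x))
    (@triv_cover _ _ _ _ A) (@triv_dom_open _ _ _ _ A)
    (fun i x ix => dual_frame_basis (frame_basis ix))
    (@dual_frame_smooth r A).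

Context (r s : nat) (A : vbundle M r) (B : vbundle M s).

Lemma sum_cover (x : M) : exists ij : triv_idx A * triv_idx B,
  (triv_dom A ij.1 `&` triv_dom B ij.2) x.
Proof.
by have [i ix] := triv_cover A x; have [j jx] := triv_cover B x; exists (i, j).
Qed.

Lemma sum_frame_smooth (i j : triv_idx A * triv_idx B) (k l : 'I_(r + s)) :
  smooth_on ((triv_dom A i.1 `&` triv_dom B i.2) `&`
             (triv_dom A j.1 `&` triv_dom B j.2))
    (fun x => coord (sum_frame (frame A j.1 x) (frame B j.2 x)) k
                    (sum_frame (frame A i.1 x) (frame B i.2 x))`_l).
Proof.
set W := (X in smooth_on X _).
have oW : open W by do 2!apply: openI; exact: triv_dom_open.
pose u x := (sum_frame (frame A i.1 x) (frame B i.2 x))`_l.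
apply: (@smooth_on_ext _ _ _ _ (fun x => match fintype.split k with
    inl k' => coord (frame A j.1 x) k' (u x).1
  | inr k' => coord (frame B j.2 x) k' (u x).2 end)) => //.
  by move=> x [_ [jx1 jx2]]; rewrite (coord_sum_frame (frame_basis jx1) (frame_basis jx2)).
rewrite /u; case: (split_ordP l) => l' -> ; case: (fintype.split k) => k'.
- rewrite (_ : (fun x => _) = fun x => coord (frame A j.1 x) k' (frame A i.1 x)`_l').
    by apply: smooth_on_sub (frame_smooth _ _ _ _) => x [[? ?] [? ?]].
  by apply/funext => x; rewrite sum_frame_l.
- rewrite (_ : (fun x => _) = fun=> 0); first exact: smooth_on_cst.
  by apply/funext => x; rewrite sum_frame_l linear0.
- rewrite (_ : (fun x => _) = fun=> 0); first exact: smooth_on_cst.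
  by apply/funext => x; rewrite sum_frame_r linear0.
- rewrite (_ : (fun x => _) = fun x => coord (frame B j.2 x) k' (frame B i.2 x)`_l').
    by apply: smooth_on_sub (frame_smooth _ _ _ _) => x [[? ?] [? ?]].
  by apply/funext => x; rewrite sum_frame_r.
Qed.

Definition whitney_sum : vbundle M (r + s) :=
  @VBundle R n M (r + s) (fun x => (A x * B x)%type)
    (triv_idx A * triv_idx B)%type
    (fun ij => triv_dom A ij.1 `&` triv_dom B ij.2)
    (fun ij x => sum_frame (frame A ij.1 x) (frame B ij.2 x))
    sum_cover
    (fun ij => openI (triv_dom_open ij.1) (triv_dom_open ij.2))
    (fun ij x ijx => sum_frame_basis (frame_basis ijx.1) (frame_basis ijx.2))
    sum_frame_smooth.

End Bundles.

Definition ev (R : realType) (n : nat) (M : manifold R n) (r : nat)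
    (A : vbundle M r) (x : M) : 'Hom(A x, dual (dual A) x) :=
  linfun (fun v : A x => linfun (fun a : dual A x => (a v : R^o))).

Lemma evE (R : realType) (n : nat) (M : manifold R n) (r : nat)
    (A : vbundle M r) (x : M) (v : A x) (a : dual A x) : ev A x v a = a v.
Proof.
pose h (w : A x) : dual A x -> R^o := fun a => a w.
have hl w : linear (h w) by move=> c p q; rewrite /h add_lfunE scale_lfunE.
pose H w := HB.pack_for {linear dual A x -> R^o} (h w)
  (GRing.isLinear.Build _ _ _ _ (h w) (hl w)).
pose g (w : A x) : dual (dual A) x := linfun (H w).
have gl : linear g.
  move=> c p q; apply/lfunP => b.
  by rewrite add_lfunE scale_lfunE !lfunE /= /h linearP.
pose G := HB.pack_for {linear A x -> dual (dual A) x} g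
  (GRing.isLinear.Build _ _ _ _ g gl).
have -> : ev A x = linfun G by [].
by rewrite lfunE /= lfunE.
Qed.

(* Smooth sections of the second exterior power of the dual of [A], as
   alternating bilinear forms on the fibres in curried form: [w x u v] is
   w_x(u, v), so that [w x] is the map [w^flat] at [x]. *)
Record two_form (R : realType) (n : nat) (M : manifold R n) (r : nat)
    (A : vbundle M r) := TwoForm {
  flat :> forall x : M, 'Hom(A x, dual A x);
  form_alt : forall x (v : A x), flat x v v = 0;
  form_smooth : forall (i : triv_idx A) (k l : 'I_r),
    smooth_on (triv_dom A i)
      (fun x => flat x (frame A i x)`_k (frame A i x)`_l) }.

(* Bivectors on [A] are 2-forms on [dual A], as [A] is identified with its
   bidual. *)
Definition bivector (R : realType) (n : nat) (M : manifold R n) (r : nat)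
  (A : vbundle M r) := two_form (dual A).

(* <b, p^sharp a> = p (a, b) *)
Definition sharp (R : realType) (n : nat) (M : manifold R n) (r : nat)
    (A : vbundle M r) (p : bivector A) (x : M) : 'Hom(dual A x, A x) :=
  ((ev A x)^-1 \o flat p x)%VF.

Definition is_inverse (R : realType) (n : nat) (M : manifold R n) (r : nat)
    (A : vbundle M r) (p : bivector A) (w : two_form A) : Prop :=
  forall x : M, (sharp p x \o flat w x)%VF = \1%VF.

(* The bracket acts on arbitrary sections, but all its properties are only
   required on smooth ones. *)
Record lie_algebroid (R : realType) (n : nat) (M : manifold R n) (r : nat)
    (A : vbundle M r) := LieAlgebroid {
  anchor : forall x : M, A x -> (M -> R) -> R;
  lie_br : section A -> section A -> section A;
  anchor_tangent : forall x (v : A x), tangent_vector x (anchor v);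
  anchor_linear : forall x f (c : R) (u v : A x), smooth f ->
    anchor (c *: u + v) f = c * anchor u f + anchor v f;
  anchor_smooth : forall (X : section A) f, smooth_section X -> smooth f ->
    smooth (fun x => anchor (X x) f);
  lie_br_smooth : forall X Y, smooth_section X -> smooth_section Y ->
    smooth_section (lie_br X Y);
  lie_br_linear : forall (c : R) X Y Z, smooth_section X ->
    smooth_section Y -> smooth_section Z -> forall x,
    lie_br (fun y => c *: X y + Y y) Z x = c *: lie_br X Z x + lie_br Y Z x;
  lie_br_skew : forall X Y, smooth_section X -> smooth_section Y ->
    forall x, lie_br X Y x = - lie_br Y X x;
  lie_br_jacobi : forall X Y Z, smooth_section X -> smooth_section Y ->
    smooth_section Z -> forall x,
    lie_br X (lie_br Y Z) x + lie_br Y (lie_br Z X) x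
      + lie_br Z (lie_br X Y) x = 0;
  lie_br_leibniz : forall f X Y, smooth f -> smooth_section X ->
    smooth_section Y -> forall x,
    lie_br X (fun y => f y *: Y y) x
      = f x *: lie_br X Y x + anchor (X x) f *: Y x }.

Arguments anchor {R n M r A} l x v f.
Arguments lie_br {R n M r A} l X Y x.

Section Calculus.
Context (R : realType) (n : nat) (M : manifold R n) (r : nat)
        (A : vbundle M r) (mu : lie_algebroid A).
Implicit Types (X Y Z : section A) (a b : section (dual A)).

Definition pairing a X : M -> R := fun x => a x (X x).

Definition anchor_fun X (f : M -> R) : M -> R := fun x => anchor mu x (X x) f.

Definition diff1 a X Y : M -> R := fun x =>
  anchor_fun X (pairing a Y) x - anchor_fun Y (pairing a X) x
  - pairing a (lie_br mu X Y) x.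

Definition diff2 (w : two_form A) X Y Z : M -> R := fun x =>
  anchor_fun X (fun y => w y (Y y) (Z y)) x
  - anchor_fun Y (fun y => w y (X y) (Z y)) x
  + anchor_fun Z (fun y => w y (X y) (Y y)) x
  - w x (lie_br mu X Y x) (Z x) + w x (lie_br mu X Z x) (Y x)
  - w x (lie_br mu Y Z x) (X x).

(* The section of [dual A] representing a functional on the smooth sections
   of [A].  It is used for functionals that are linear over the smooth
   functions, which are represented by a unique smooth section. *)
Definition covector_of (phi : section A -> M -> R) : section (dual A) :=
  fun x => xget (0 : 'Hom(A x, R^o))
    [set c : 'Hom(A x, R^o) | forall Y, smooth_section Y -> c (Y x) = phi Y x].

(* L_X a *)
Definition lie_der X a : section (dual A) :=
  covector_of (fun Y x =>
    anchor_fun X (pairing a Y) x - pairing a (lie_br mu X Y) x).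

(* i_X d a *)
Definition contr_diff X a : section (dual A) := covector_of (diff1 a X).

(* L_X P on a pair of 1-forms, for a bivector field [P] given by its values
   on pairs of sections of [dual A]. *)
Definition lie_der_bivector X
    (P : section (dual A) -> section (dual A) -> M -> R) a b : M -> R :=
  fun x => anchor_fun X (P a b) x - P (lie_der X a) b x - P a (lie_der X b) x.

Definition symplectic (w : two_form A) : Prop :=
  (forall x, lker (flat w x) == 0%VS) /\
  (forall X Y Z, smooth_section X -> smooth_section Y -> smooth_section Z ->
     forall x, diff2 w X Y Z x = 0).

(* The indices range over Z/3Z, as in N_i = p_(i-1)^sharp o w_(i+1)^flat. *)
Definition hypersymplectic (eps : 'Z_3 -> R) (w : 'Z_3 -> two_form A) : Prop :=
  (forall i, symplectic (w i)) /\
  exists p : 'Z_3 -> bivector A,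
    (forall i, is_inverse (p i) (w i)) /\
    forall i x, let N := (sharp (p (i - 1)) x \o flat (w (i + 1)) x)%VF in
      (N \o N)%VF = eps i *: \1%VF.

End Calculus.

Arguments anchor_fun {R n M r A} mu X f x.
Arguments diff1 {R n M r A} mu a X Y x.
Arguments lie_der {R n M r A} mu X a x.
Arguments contr_diff {R n M r A} mu X a x.
Arguments lie_der_bivector {R n M r A} mu X P a b x.
Arguments hypersymplectic {R n M r A} mu eps w.

Section Double.
Context (R : realType) (n : nat) (M : manifold R n) (r : nat)
        (A : vbundle M r) (mu : lie_algebroid A)
        (gamma : lie_algebroid (dual A)).

Definition ev_section (X : section A) : section (dual (dual A)) :=
  fun x => ev A x (X x).

(* d_* X, as a bivector evaluated on pairs of sections of [dual A]. *)
Definition dstar (X : section A) : section (dual A) -> section (dual A) ->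
  M -> R := diff1 gamma (ev_section X).

(* d_* [X, Y] = L_X (d_* Y) - L_Y (d_* X) *)
Definition lie_bialgebroid : Prop :=
  forall X Y a b, smooth_section X -> smooth_section Y ->
    smooth_section a -> smooth_section b -> forall x,
    dstar (lie_br mu X Y) a b x =
      lie_der_bivector mu X (dstar Y) a b x
      - lie_der_bivector mu Y (dstar X) a b x.

End Double.

(* The data (rho, [.,.]) that deformations act on.  The Courant algebroid
   axioms are not part of it: they hold for [double_courant] below because mu
   and gamma form a Lie bialgebroid. *)
Record courant_data (R : realType) (n : nat) (M : manifold R n) (r : nat)
    (E : vbundle M r) := CourantData {
  c_anchor : forall x : M, E x -> (M -> R) -> R;
  dorfman : section E -> section E -> section E }.

Arguments c_anchor {R n M r E} c x v f.
Arguments dorfman {R n M r E} c e1 e2 x.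

Section Courant.
Context (R : realType) (n : nat) (M : manifold R n) (r : nat)
        (E : vbundle M r).
Implicit Types (T : courant_data E) (I J : forall x : M, 'End(E x)).

Definition eq_courant T T' : Prop :=
  (forall x (v : E x) f, smooth f -> c_anchor T x v f = c_anchor T' x v f) /\
  (forall e1 e2, smooth_section e1 -> smooth_section e2 ->
     forall x, dorfman T e1 e2 x = dorfman T' e1 e2 x).

Definition scale_courant (c : R) T : courant_data E :=
  CourantData (fun x v f => c * c_anchor T x v f)
              (fun e1 e2 x => c *: dorfman T e1 e2 x).

Definition deform T I : courant_data E :=
  CourantData (fun x v f => c_anchor T x (I x v) f)
    (fun e1 e2 x => dorfman T (fun y => I y (e1 y)) e2 x
                    + dorfman T e1 (fun y => I y (e2 y)) x
                    - I x (dorfman T e1 e2 x)).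

Definition skew_endo (form : forall x : M, E x -> E x -> R) I : Prop :=
  forall x u v, form x (I x u) v = - form x u (I x v).

Definition courant_hypersymplectic (form : forall x : M, E x -> E x -> R) T
    (eps : 'Z_3 -> R) (S : 'Z_3 -> forall x : M, 'End(E x)) : Prop :=
  [/\ (forall i, smooth_endo (S i) /\ skew_endo form (S i)),
      (forall i x, (S i x \o S i x)%VF = eps i *: \1%VF),
      (forall i j x, i != j ->
         (S i x \o S j x)%VF = (\prod_k eps k) *: (S j x \o S i x)%VF)
    & (forall i, eq_courant (deform (deform T (S i)) (S i))
                            (scale_courant (eps i) T))].

End Courant.

Section DoubleCourant.
Context (R : realType) (n : nat) (M : manifold R n) (r : nat)
        (A : vbundle M r).

Definition double_bundle : vbundle M (r + r) := whitney_sum A (dual A).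

Definition double_form (x : M) (u v : double_bundle x) : R :=
  u.2 v.1 + v.2 u.1.

Definition double_courant (mu : lie_algebroid A)
    (gamma : lie_algebroid (dual A)) : courant_data double_bundle :=
  @CourantData R n M (r + r) double_bundle
    (fun x u f => anchor mu x u.1 f + anchor gamma x u.2 f)
    (fun e1 e2 =>
      let X : section A := fun y => (e1 y).1 in
      let a : section (dual A) := fun y => (e1 y).2 in
      let Y : section A := fun y => (e2 y).1 in
      let b : section (dual A) := fun y => (e2 y).2 in
      fun x =>
      (lie_br mu X Y x
       + (ev A x)^-1%VF (lie_der gamma a (ev_section Y) x
                         - contr_diff gamma b (ev_section X) x),
       lie_br gamma a b x + lie_der mu X b x - contr_diff mu Y a x)).

(* The endomorphism (X + a) |-> c p^sharp(a) + w^flat(X). *)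
Definition double_endo (c : R) (w : two_form A) (p : bivector A) (x : M) :
    'End(double_bundle x) :=
  linfun (fun u : (A x * dual A x)%type =>
            ((c *: sharp p x u.2, flat w x u.1) : (A x * dual A x)%type)).

Lemma double_endoE (c : R) (w : two_form A) (p : bivector A) (x : M)
    (u : double_bundle x) :
  double_endo c w p x u = (c *: sharp p x u.2, flat w x u.1).
Proof.
pose g (u : (A x * dual A x)%type) : (A x * dual A x)%type :=
  (c *: sharp p x u.2, flat w x u.1).
have gl : linear g.
  move=> d v z; rewrite /g !linearP /=.
  by congr pair; rewrite scalerDr !scalerA mulrC.
pose G := HB.pack_for {linear (A x * dual A x)%type -> (A x * dual A x)%type} g
  (GRing.isLinear.Build _ _ _ _ g gl).
have -> : double_endo c w p x = linfun G by [].
by rewrite lfunE.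
Qed.

End DoubleCourant.

(* Main.v *)
(* For [S = double_endo eps w p] with [p] inverse to [w] one has [S^2 = eps], so
   the second deformation of the Dorfman bracket by [S] is [eps] times the
   bracket plus twice the Nijenhuis torsion of [S].  The torsion is bilinear and
   satisfies [torsion (S e) e' = - S (torsion e e')], and likewise in the second
   argument; as [S] exchanges [A] and its dual, the torsion vanishes as soon as
   it does on sections of [A].  There its two components are the images, under
   isomorphisms, of [i_Y i_X dw = L_X (w Y) - i_Y d (w X) - w [X, Y]] and of the
   same expression for [p] on the dual algebroid, at [w X] and [w Y].  Hence the
   Courant condition says exactly that [w] and [p] are closed.  The remaining
   conditions are linear algebra in each fibre: [S_i^2 = eps_i] means that [p_i]
   is inverse to [w_i], and the commutation rules mean [N_k^2 = eps_k].

   The covectors [L_X a] and [i_X d a] are given by functionals on global smooth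
   sections; that these functionals are pointwise is the usual localisation
   argument, which needs smooth bump functions on the manifold. *)
Require Import Defs.
From mathcomp Require Import all_boot all_order all_algebra.
From mathcomp Require Import all_classical all_reals all_analysis.
From mathcomp Require Import ring lra.

Set Implicit Arguments.
Unset Strict Implicit.
Unset Printing Implicit Defensive.

Import Order.TTheory GRing.Theory Num.Theory.
Import numFieldNormedType.Exports.

Local Open Scope classical_set_scope.
Local Open Scope ring_scope.

(** * Smooth functions *)

Section FlatExp.
Context (R : realType).

(** The powers of 1/t are those that appear when exp(-1/t) is differentiated repeatedly. Including
    them makes the family closed under differentiation up to constant coefficients. *)
Definition flat_exp (m : nat) (t : R) : R :=
  if 0 < t then t ^- m * expR (- t^-1) else 0.

Lemma flat_exp_gt0 m t : 0 < t -> 0 < flat_exp m t.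
Proof. by move=> t0; rewrite /flat_exp t0 mulr_gt0 ?expR_gt0 ?invr_gt0 ?exprn_gt0. Qed.

Lemma flat_exp_le0 m t : t <= 0 -> flat_exp m t = 0.
Proof. by move=> t0; rewrite /flat_exp ltNge t0. Qed.

Lemma flat_exp_ge0 m t : 0 <= flat_exp m t.
Proof. by have [/(flat_exp_gt0 m)/ltW|/(flat_exp_le0 m)->] := ltP 0 t. Qed.

Lemma flat_expS m t : flat_exp m.+1 t = t^-1 * flat_exp m t.
Proof.
by rewrite /flat_exp; case: ifP => t0; rewrite ?mulr0 // exprS invfM mulrA.
Qed.

(** With N = m+1 and t > 0, exp(1/t) is the N-th power of exp(1/(tN)), which is at least 1/(tN) by
    [expR_ge1Dx]. Hence exp(-1/t) is at most (tN)^N, and one factor t survives division by t^m. The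
    bound controls the difference quotients at 0. *)
Lemma flat_exp_le m t : flat_exp m t <= (m.+1%:R ^+ m.+1) * `|t|.
Proof.
have [t0|t0] := ltP 0 t; last by rewrite flat_exp_le0 // mulr_ge0 ?exprn_ge0.
rewrite /flat_exp t0 (gtr0_norm t0) expRN.
have N0 : 0 < m.+1%:R :> R by [].
have -> : expR t^-1 = expR (t * m.+1%:R)^-1 ^+ m.+1.
  by rewrite -expRM_natl; congr expR; rewrite invfM mulrCA mulfV ?mulr1 ?lt0r_neq0.
have le : (t * m.+1%:R) ^- m.+1 <= expR (t * m.+1%:R)^-1 ^+ m.+1.
  rewrite -exprVn lerXn2r ?nnegrE ?expR_ge0 ?invr_ge0 ?mulr_ge0 1?ltW //.
  by apply: lt_le_trans (expR_ge1Dx _); rewrite ltrDr.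
rewrite mulrC ler_pdivrMr ?exprn_gt0 //.
rewrite -mulrA -exprS -exprMn [_%:R * _]mulrC.
by rewrite -[leRHS]invrK lef_pV2 ?posrE ?invr_gt0 ?exprn_gt0 ?mulr_gt0 ?expR_gt0.
Qed.

Lemma is_derive_flat_exp m (t : R) : is_derive t (1 : R) (flat_exp m)
  (flat_exp m.+2 t - m%:R * flat_exp m.+1 t).
Proof.
have [t0|t0|->] := ltgtP t 0.
- rewrite !flat_exp_le0 1?ltW // mulr0 subr0.
  apply: (@near_eq_is_derive _ _ _ (cst 0)) => //.
  near=> s; rewrite /= flat_exp_le0 // ltW //; near: s.
  exact: lt_nbhsl.
- have tn0 := lt0r_neq0 t0.
  apply: (@near_eq_is_derive _ _ _ (fun s : R => s ^- m * expR (- s^-1))).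
    near=> s; rewrite /flat_exp ifT //; near: s; exact: lt_nbhsr.
  have d1 : is_derive t 1 (fun s : R => s ^+ m) ((m%:R * t ^+ m.-1) *: 1).
    have -> : (fun s : R => s ^+ m) = (id : R -> R) ^+ m by rewrite exprfctE.
    exact: is_deriveX.
  have d2 : is_derive t 1 (fun s : R => s ^- m)
      (- (t ^+ m) ^- 2 *: ((m%:R * t ^+ m.-1) *: 1)).
    by apply: is_deriveV; rewrite expf_neq0.
  have d3 : is_derive t 1 (fun s : R => - s^-1) (- (- t ^- 2 *: 1)).
    by apply: is_deriveN; apply: is_deriveV.
  have d4 := is_derive1_comp (is_derive_expR _) d3.
  apply: is_derive_eq (is_deriveM d2 d4) _.
  rewrite /flat_exp t0 /= /GRing.scale /= !mulr1.
  case: m {d1 d2} => [|m]; first by field.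
  by rewrite /= !exprS; field; rewrite expf_neq0.
- rewrite !flat_exp_le0 // mulr0 subr0.
  (* At the origin the difference quotient of [flat_exp m] at step h is [flat_exp m.+1 h], which the
     linear bound sends to 0. *)
  suff h : (fun h : R => h^-1 *:
      ((flat_exp m \o shift 0) (h *: 1) - flat_exp m 0)) @ 0^' --> (0 : R).
    by apply: DeriveDef; [apply/cvg_ex; exists 0 | exact: cvg_lim].
  apply/cvgr0Pnorm_le => e e0.
  near=> h; rewrite /= /GRing.scale /= mulr1 addr0 [flat_exp m 0]flat_exp_le0 // subr0.
  rewrite -flat_expS ger0_norm ?flat_exp_ge0 //.
  apply: le_trans (flat_exp_le _ _) _.
  have C0 : 0 < m.+2%:R ^+ m.+2 :> R by rewrite exprn_gt0.
  rewrite mulrC -ler_pdivlMr //; near: h.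
  have : \forall h \near (0 : R), `|h| <= e / m.+2%:R ^+ m.+2.
    by apply: nbhs0_le; rewrite divr_gt0.
  exact: nbhs_dnbhs.
Unshelve. all: by end_near. Qed.

(** Only the derivative of [f] along [v] is available, not its differential. The chain rule is
    therefore reduced to one real variable by restricting [f] to the line s |-> s v + y. *)
Lemma is_derive_comp1 (V : normedModType R) (h : R -> R) (f : V -> R) (y v : V) dh df :
  is_derive (f y) (1 : R) h dh -> is_derive y v f df ->
  is_derive y v (h \o f) (dh * df).
Proof.
move=> dh' df'.
pose g (s : R) := f (s *: v + y).
have shift_derive (k : V -> R) d : is_derive y v k d <->
    is_derive (0 : R) (1 : R) (fun s : R => k (s *: v + y)) d.
  have E : (fun s : R => s^-1 *: ((k \o shift y) (s *: v) - k y)) =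
    (fun s : R => s^-1 *: (((fun s : R => k (s *: v + y)) \o shift 0) (s *: 1)
                           - k (0 *: v + y))).
    by apply/funext => s /=; rewrite addr0 scale0r add0r /GRing.scale /= mulr1.
  split=> -[d1 d2]; apply: DeriveDef.
  - by rewrite /derivable -E.
  - by rewrite -d2 /derive -E.
  - by rewrite /derivable E.
  - by rewrite -d2 /derive E.
apply/shift_derive; apply: (@is_derive1_comp R h g 0 dh df).
  by rewrite /g scale0r add0r.
exact/shift_derive.
Qed.

End FlatExp.

(** * Closure properties of C^k functions on subsets of R^n *)

Section CkCalculus.
Context (R : realType) (n : nat).
Implicit Types (U V : set 'rV[R]_n) (f g : 'rV[R]_n -> R).

Lemma Ck_onW k U f : Ck_on k.+1 U f -> Ck_on k U f.
Proof.
elim: k f => [|k IH] f; first by case.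
by case=> cf df; split=> // j; have [dfj /IH] := df j.
Qed.

(** [Ck_on] collects conditions at single points of the set, on iterated partial derivatives taken
    in the whole space, so it can be checked point by point. *)
Lemma Ck_on_local k U f :
  (forall y, U y -> exists2 V, V y & Ck_on k V f) -> Ck_on k U f.
Proof.
elim: k f => [|k IH] f loc.
  by split=> // y /loc[V Vy [cf _]]; exact: cf.
split=> [y /loc[V Vy [cf _]]|j]; first exact: cf.
split=> [y /loc[V Vy [_ /(_ j)[df _]]]|]; first exact: df.
by apply: IH => y /loc[V Vy [_ /(_ j)[_ Cf]]]; exists V.
Qed.

Lemma Ck_onD k U f g : open U -> Ck_on k U f -> Ck_on k U g ->
  Ck_on k U (fun y => f y + g y).
Proof.
move=> oU; elim: k f g => [|k IH] f g [cf df] [cg dg].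
  by split=> // y Uy; exact: continuousD (cf _ Uy) (cg _ Uy).
split=> [y Uy|j]; first by exact: continuousD (cf _ Uy) (cg _ Uy).
have [dfj Cf] := df j; have [dgj Cg] := dg j.
split=> [y Uy|]; first by apply: derivableD; [exact: dfj | exact: dgj].
apply: Ck_on_ext (IH _ _ Cf Cg) => // y Uy.
by rewrite -deriveD //; [exact: dfj | exact: dgj].
Qed.

Lemma Ck_onM k U f g : open U -> Ck_on k U f -> Ck_on k U g ->
  Ck_on k U (fun y => f y * g y).
Proof.
move=> oU; elim: k f g => [|k IH] f g Cf Cg.
  have [[cf _] [cg _]] := (Cf, Cg).
  by split=> // y Uy; exact: continuousM (cf _ Uy) (cg _ Uy).
(* The product rule multiplies derivatives by the functions themselves, which are therefore also
   needed at the lower order [k]. *)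
have [Cf' Cg'] := (Ck_onW Cf, Ck_onW Cg).
have [[cf df] [cg dg]] := (Cf, Cg).
split=> [y Uy|j]; first by exact: continuousM (cf _ Uy) (cg _ Uy).
have [dfj Cfj] := df j; have [dgj Cgj] := dg j.
split=> [y Uy|]; first by apply: derivableM; [exact: dfj | exact: dgj].
have := Ck_onD oU (IH _ _ Cf' Cgj) (IH _ _ Cg' Cfj).
apply: Ck_on_ext => // y Uy.
by rewrite (deriveM (dfj _ Uy) (dgj _ Uy)).
Qed.

(* The derivative of [flat_exp m] is a combination of [flat_exp m.+1] and
   [flat_exp m.+2], so the induction on [k] is uniform in [m]. *)
Lemma Ck_on_flat_exp k m U f : open U -> Ck_on k U f ->
  Ck_on k U (fun y => flat_exp m (f y)).
Proof.
move=> oU; have cts l y : {for y, continuous f} ->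
    {for y, continuous (fun y => flat_exp l (f y))}.
  move=> cf; apply: (@continuous_comp _ _ _ f) => //.
  have [d _] := is_derive_flat_exp l (f y).
  exact/differentiable_continuous/derivable1_diffP.
elim: k m => [|k IH] m Cf.
  by have [cf _] := Cf; split=> // y Uy; apply: cts; exact: cf.
have [cf df] := Cf; split=> [y Uy|j]; first by apply: cts; exact: cf.
have [dfj Cfj] := df j.
have dcomp y : U y -> is_derive y (delta_mx 0 j) (fun y => flat_exp m (f y))
    ((flat_exp m.+2 (f y) - m%:R * flat_exp m.+1 (f y)) *
     'D_(delta_mx 0 j) f y).
  move=> Uy; apply: is_derive_comp1; first exact: is_derive_flat_exp.
  exact/derivableP/dfj.
split=> [y Uy|]; first by have [] := dcomp _ Uy.
apply: (@Ck_on_ext _ _ _ _ (fun y =>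
    (flat_exp m.+2 (f y) + - m%:R * flat_exp m.+1 (f y)) *
     'D_(delta_mx 0 j) f y)) => // [y Uy|].
  by have [_ ->] := dcomp _ Uy; rewrite mulNr.
have Cf' := Ck_onW Cf.
apply: Ck_onM => //; apply: Ck_onD => //; first exact: IH.
by apply: Ck_onM => //; [exact: Ck_on_cst | exact: IH].
Qed.

End CkCalculus.

(** * Smooth functions and bump functions on a manifold *)

Section SmoothCalculus.
Context (R : realType) (n : nat) (M : manifold R n).
Implicit Types (W V : set M) (f g : M -> R).

Lemma smooth_onD W f g : open W -> smooth_on W f -> smooth_on W g ->
  smooth_on W (fun x => f x + g x).
Proof.
by move=> oW sf sg a k; apply: Ck_onD (sf a k) (sg a k); exact: chart_img_openI.
Qed.

Lemma smooth_onM W f g : open W -> smooth_on W f -> smooth_on W g ->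
  smooth_on W (fun x => f x * g x).
Proof.
by move=> oW sf sg a k; apply: Ck_onM (sf a k) (sg a k); exact: chart_img_openI.
Qed.

Lemma smooth_onN W f : open W -> smooth_on W f -> smooth_on W (fun x => - f x).
Proof.
move=> oW sf; apply: (@smooth_on_ext _ _ _ _ (fun x => -1 * f x)) => //.
  by move=> x _; rewrite mulN1r.
by apply: smooth_onM => //; exact: smooth_on_cst.
Qed.

Lemma smooth_on_sum W (I : Type) (s : seq I) (F : I -> M -> R) : open W ->
  (forall i, smooth_on W (F i)) -> smooth_on W (fun x => \sum_(i <- s) F i x).
Proof.
move=> oW sF; elim: s => [|i s IH].
  by apply: (smooth_on_ext oW _ (smooth_on_cst _ 0)) => x _; rewrite big_nil.
by apply: (smooth_on_ext oW _ (smooth_onD oW (sF i) IH)) => x _; rewrite big_cons.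
Qed.

Lemma smooth_on_flat_exp m W f : open W -> smooth_on W f ->
  smooth_on W (fun x => flat_exp m (f x)).
Proof.
by move=> oW sf a k; apply: Ck_on_flat_exp (sf a k); exact: chart_img_openI.
Qed.

Lemma smooth_on_local W f :
  (forall x, W x -> exists2 V, V x & smooth_on V f) -> smooth_on W f.
Proof.
move=> loc a k; apply: Ck_on_local => _ [x [ax Wx] <-].
have [V Vx sf] := loc _ Wx.
by exists (chart a @` (chart_dom a `&` V)); [exists x | exact: sf].
Qed.

Lemma smooth_on_chart (b : chart_idx M) (j : 'I_n) :
  smooth_on (chart_dom b) (fun x => chart b x 0 j).
Proof. by move=> a; exact: chart_smooth. Qed.

Lemma smoothM f g : smooth f -> smooth g -> smooth (fun x => f x * g x).
Proof. by move=> sf sg; apply: smooth_onM => //; exact: openT. Qed.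

(** In a chart at [x], compose the flat exponential with d^2 - |y - c|^2 and normalise at the centre
    c. [K] is the image in the manifold of a closed coordinate box; it is compact, hence closed
    because the manifold is Hausdorff, and this makes the extension by zero smooth. *)
Lemma smooth_bump W (x : M) : open W -> W x -> exists (chi : M -> R) (K : set M),
  [/\ smooth chi, chi x = 1, closed K, K `<=` W & forall y, ~ K y -> chi y = 0].
Proof.
move=> oW Wx; have [a ax] := chart_cover x.
have oD : open (chart_dom a `&` W) by apply: openI => //; exact: chart_dom_open.
pose c := chart a x.
have [e e0 Be] : exists2 e : R, 0 < e &
    forall y : 'rV[R]_n, (forall j, `|c 0 j - y 0 j| < e) ->
      (chart a @` (chart_dom a `&` W)) y.
  have : nbhs c (chart a @` (chart_dom a `&` W)).
    by apply: open_nbhs_nbhs; split; [exact: chart_img_openI | exists x].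
  move=> /nbhs_ballP[e /= e0 Be]; exists e => // y cy; apply: Be.
  by split=> // i j; rewrite (ord1 i); exact: cy.
(* Halving the radius places the closed box of half-width [d] inside the open ball of radius [e]. *)
pose d := e / 2; have d0 : 0 < d by rewrite divr_gt0.
pose box := [set y : 'rV[R]_n | forall j, `[c 0 j - d, c 0 j + d]%classic (y ord0 j)].
have boxW y : box y -> (chart a @` (chart_dom a `&` W)) y.
  move=> yb; apply: Be => j; have := yb j; rewrite /= in_itv /= => /andP[l u].
  rewrite ltr_norml; apply/andP; split; rewrite /d in l u; lra.
have box_compact : compact box.
  by apply: (@rV_compact _ n (fun j => `[c 0 j - d, c 0 j + d]%classic)) => j;
    exact: segment_compact.
pose K := chart_inv a @` box.
have K_closed : closed K.
  apply: compact_closed; first exact: mfd_hausdorff.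
  apply: continuous_compact => //; apply: continuous_in_subspaceT => y.
  rewrite inE => /boxW[z [az Wz] <-]; apply: chart_inv_continuous; by exists z.
(* [q] is positive only where the Euclidean distance to the centre is less than [d], which forces
   every coordinate into the box. *)
pose q (y : M) := d ^+ 2 + - \sum_j (chart a y 0 j + - c 0 j) * (chart a y 0 j + - c 0 j).
have sq : smooth_on (chart_dom a) q.
  have oa := @chart_dom_open _ _ M a.
  apply: smooth_onD => //; first exact: smooth_on_cst.
  apply: smooth_onN => //; apply: smooth_on_sum => // j.
  have s1 : smooth_on (chart_dom a) (fun y => chart a y 0 j + - c 0 j).
    by apply: smooth_onD => //; [exact: smooth_on_chart | exact: smooth_on_cst].
  exact: smooth_onM.
have qx : q x = d ^+ 2.
  by rewrite /q big1 ?oppr0 ?addr0 // => j _; rewrite subrr mul0r.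
have C0 : flat_exp 0 (d ^+ 2) != 0.
  by rewrite lt0r_neq0 // flat_exp_gt0 // exprn_gt0.
(* Chart values outside the chart domain are arbitrary, so the value 0 is imposed there. *)
pose chi (y : M) := if `[< chart_dom a y >]
  then (flat_exp 0 (d ^+ 2))^-1 * flat_exp 0 (q y) else 0.
have chiE y : chart_dom a y -> (flat_exp 0 (d ^+ 2))^-1 * flat_exp 0 (q y) = chi y.
  by move=> ay; rewrite /chi asboolT.
have chi_out y : ~ K y -> chi y = 0.
  move=> nK; rewrite /chi; case: asboolP => // ay.
  have [q0|q0] := leP (q y) 0; first by rewrite (flat_exp_le0 _ q0) mulr0.
  case: nK.
  exists (chart a y); last exact: chartK.
  move=> j; rewrite /= in_itv /=.
  have : (chart a y 0 j - c 0 j) ^+ 2 <= d ^+ 2.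
    apply: le_trans (_ : \sum_j (chart a y 0 j + - c 0 j) *
                                (chart a y 0 j + - c 0 j) <= _).
      rewrite (bigD1 j) //= -expr2 lerDl; apply: sumr_ge0 => i _.
      by rewrite -expr2 sqr_ge0.
    by rewrite -subr_ge0 ltW.
  by move=> h; apply/andP; split; nra.
exists chi, K; split=> //; last by move=> y [z /boxW[t [ta tW] <-] <-]; rewrite chartK.
  (* Two open sets cover the manifold: the chart domain within [W], where the formula holds, and the
     complement of [K], where [chi] vanishes. *)
  apply: smooth_on_local => y _; have [Ky|nK] := pselect (K y).
    exists (chart_dom a `&` W).
      by have [z /boxW[t [ta tW] <-] <-] := Ky; rewrite chartK.
    apply: (smooth_on_ext oD (f := fun y =>
        (flat_exp 0 (d ^+ 2))^-1 * flat_exp 0 (q y))).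
      by move=> z [az _]; rewrite chiE.
    apply: smooth_onM => //; first exact: smooth_on_cst.
    by apply: smooth_on_flat_exp => //; apply: smooth_on_sub sq; exact: subIsetl.
  exists (~` K) => //.
  apply: (smooth_on_ext _ _ (smooth_on_cst _ 0)); first exact: closed_openC.
  by move=> z /chi_out ->.
by rewrite -chiE // qx mulVf.
Qed.

(** Extension by zero: [g] is controlled only inside [W], but the product vanishes on the open
    complement of [K], and these two sets cover [V]. *)
Lemma smooth_on_bumpM (chi : M -> R) K V W g : open V -> open W ->
  smooth chi -> closed K -> K `<=` W -> (forall y, ~ K y -> chi y = 0) ->
  smooth_on (V `&` W) g -> smooth_on V (fun y => chi y * g y).
Proof.
move=> oV oW schi cK KW chi0 sg; apply: smooth_on_local => y Vy.
have [Ky|nK] := pselect (K y).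
  exists (V `&` W); first by split=> //; exact: KW.
  apply: smooth_onM => //; first exact: openI.
  by apply: smooth_on_sub schi => z.
exists (~` K) => //.
apply: (smooth_on_ext _ _ (smooth_on_cst _ 0)); first exact: closed_openC.
by move=> z /chi0 ->; rewrite mul0r.
Qed.

End SmoothCalculus.

(** * Smooth sections *)

(** A left inverse makes [f] injective; equality of dimensions then makes it onto. *)
Lemma lfun_inverse_sym (K : fieldType) (U V : vectType K) (f : 'Hom(U, V))
    (g : 'Hom(V, U)) :
  \dim {:U} = \dim {:V} -> (g \o f)%VF = \1%VF -> (f \o g)%VF = \1%VF.
Proof.
move=> dUV gf; have gfE u : g (f u) = u by rewrite -comp_lfunE gf id_lfunE.
have kf : lker f == 0%VS.
  by apply/lker0P => u v fuv; rewrite -(gfE u) fuv gfE.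
have limf : limg f = fullv.
  apply/eqP; rewrite eqEdim subvf /= limg_dim_eq ?dUV //.
  by move/eqP: kf => ->; rewrite capv0.
apply/lfunP => v; rewrite comp_lfunE id_lfunE.
by have /memv_imgP[u _ ->] : v \in limg f; rewrite ?limf ?memvf // gfE.
Qed.

Section SmoothSections.
Context (R : realType) (n : nat) (M : manifold R n).

Definition smooth_section_on (r : nat) (A : vbundle M r) (W : set M)
    (s : section A) : Prop :=
  forall (i : triv_idx A) (k : 'I_r),
    smooth_on (W `&` triv_dom A i) (fun x => coord (frame A i x) k (s x)).

Section OneBundle.
Context (r : nat) (A : vbundle M r).
Implicit Types (W : set M) (X Y : section A).

Lemma smooth_sectionE X : smooth_section X <-> smooth_section_on [set: M] X.
Proof. by split=> sX i k; have := sX i k; rewrite setTI. Qed.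

Lemma smooth_on_triv W (f : M -> R) :
  (forall i, smooth_on (W `&` triv_dom A i) f) -> smooth_on W f.
Proof.
move=> sf; apply: smooth_on_local => x Wx; have [i ix] := triv_cover A x.
by exists (W `&` triv_dom A i).
Qed.

Lemma frame_smooth_section_on (i : triv_idx A) (l : 'I_r) :
  smooth_section_on (triv_dom A i) (fun x => (frame A i x)`_l).
Proof. by move=> j k; exact: frame_smooth. Qed.

Lemma fiber_dim (x : M) : \dim {:A x} = r.
Proof.
have [i ix] := triv_cover A x.
by rewrite (size_basis (frame_basis ix)).
Qed.

Lemma smooth_section_onD W X Y : open W -> smooth_section_on W X ->
  smooth_section_on W Y -> smooth_section_on W (fun x => X x + Y x).
Proof.
move=> oW sX sY i k.
have o : open (W `&` triv_dom A i) by apply: openI => //; exact: triv_dom_open.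
apply: (smooth_on_ext o _ (smooth_onD o (sX i k) (sY i k))) => x _.
by rewrite linearD.
Qed.

Lemma smooth_section_onZ W (f : M -> R) X : open W -> smooth_on W f ->
  smooth_section_on W X -> smooth_section_on W (fun x => f x *: X x).
Proof.
move=> oW sf sX i k.
have o : open (W `&` triv_dom A i) by apply: openI => //; exact: triv_dom_open.
have sf' : smooth_on (W `&` triv_dom A i) f by apply: smooth_on_sub sf; exact: subIsetl.
by apply: (smooth_on_ext o _ (smooth_onM o sf' (sX i k))) => x _; rewrite linearZ.
Qed.

Lemma smooth_sectionD X Y : smooth_section X -> smooth_section Y ->
  smooth_section (fun x => X x + Y x).
Proof.
move=> /smooth_sectionE sX /smooth_sectionE sY; apply/smooth_sectionE.
by apply: smooth_section_onD => //; exact: openT.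
Qed.

Lemma smooth_sectionZ (f : M -> R) X : smooth f -> smooth_section X ->
  smooth_section (fun x => f x *: X x).
Proof.
move=> sf /smooth_sectionE sX; apply/smooth_sectionE.
by apply: smooth_section_onZ => //; exact: openT.
Qed.

Lemma smooth_cst (c : R) : @smooth _ _ M (fun=> c).
Proof. exact: smooth_on_cst. Qed.

Lemma smooth_section0 : smooth_section (fun x => 0 : A x).
Proof.
move=> i k; apply: (smooth_on_ext (@triv_dom_open _ _ _ _ A i) _ (smooth_on_cst _ 0)).
by move=> x _; rewrite linear0.
Qed.

Lemma smooth_sectionZD (c : R) X Y : smooth_section X -> smooth_section Y ->
  smooth_section (fun x => c *: X x + Y x).
Proof.
by move=> sX sY; apply: smooth_sectionD => //; apply: smooth_sectionZ => //;
  exact: smooth_cst.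
Qed.

Lemma smooth_section_sum (I : Type) (s : seq I) (F : I -> section A) :
  (forall i, smooth_section (F i)) ->
  smooth_section (fun x => \sum_(i <- s) F i x).
Proof.
move=> sF; elim: s => [|i s IH].
  rewrite (_ : (fun x => _) = (fun x => 0 : A x)); first exact: smooth_section0.
  by apply: functional_extensionality_dep => x; rewrite big_nil.
rewrite (_ : (fun x => _) = (fun x => F i x + \sum_(i <- s) F i x)).
  exact: smooth_sectionD.
by apply: functional_extensionality_dep => x; rewrite big_cons.
Qed.

(* Multiplying a local frame by a bump function [chi] gives global sections
   [E k]; the square of [chi] then makes both the coordinates and the frame
   of any section global. *)
Lemma bump_frame (x : M) : exists (chi : M -> R) (E : 'I_r -> section A),
  [/\ smooth chi, chi x = 1, basis_of fullv [tuple E k x | k < r],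
      (forall k, smooth_section (E k)) &
      forall Y, smooth_section Y -> exists g : 'I_r -> M -> R,
        [/\ forall k, smooth (g k),
            forall k, g k x = coord [tuple E k x | k < r] k (Y x) &
            (fun y => (chi y * chi y) *: Y y) = (fun y => \sum_k g k y *: E k y)]].
Proof.
have [i ix] := triv_cover A x.
have oi := @triv_dom_open _ _ _ _ A i.
have [chi [K [schi chix cK KW chi0]]] := smooth_bump oi ix.
pose E (k : 'I_r) : section A := fun y => chi y *: (frame A i y)`_k.
have Ex : [tuple E k x | k < r] = frame A i x.
  apply: eq_from_tnth => k; rewrite tnth_mktuple /E chix scale1r.
  by rewrite (tnth_nth 0).
exists chi, E; split=> //.
- by rewrite Ex; exact: frame_basis.
- move=> k j l.
  have oj := @triv_dom_open _ _ _ _ A j.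
  have := smooth_on_bumpM oj oi schi cK KW chi0.
  rewrite setIC => /(_ _ (frame_smooth i j l k)).
  by apply: smooth_on_ext => // z _; rewrite /E linearZ.
move=> Y sY.
exists (fun k y => chi y * coord (frame A i y) k (Y y)); split.
- move=> k; apply: (smooth_on_bumpM openT oi schi cK KW chi0).
  by rewrite setTI; exact: sY.
- by move=> k; rewrite chix mul1r Ex.
apply: functional_extensionality_dep => y.
(* Outside the trivialisation both sides vanish with [chi], whatever the value of the frame
   there. *)
have [iy|niy] := pselect (triv_dom A i y); last first.
  rewrite chi0 => [|/KW //].
  by rewrite mul0r scale0r big1 // => k _; rewrite mul0r scale0r.
rewrite {1}(coord_basis (frame_basis iy) (memvf (Y y))) scaler_sumr.
by apply: eq_bigr => k _; rewrite /E !scalerA; congr (_ *: _); ring.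
Qed.

End OneBundle.
End SmoothSections.

(** * Localisation of functionals on global sections *)

Section Tensoriality.
Context (R : realType) (n : nat) (M : manifold R n) (r : nat) (A : vbundle M r).
Implicit Types (W : set M) (X Y : section A) (a : section (dual A)).

Lemma fiber_section (x : M) (v : A x) : exists2 X, smooth_section X & X x = v.
Proof.
have [chi [E [_ _ bE sE _]]] := bump_frame A x.
exists (fun y => \sum_k coord [tuple E k x | k < r] k v *: E k y).
  apply: smooth_section_sum => k.
  by apply: smooth_sectionZ => //; exact: smooth_cst.
rewrite [RHS](coord_basis bE (memvf v)); apply: eq_bigr => k _.
by rewrite -tnth_nth tnth_mktuple.
Qed.

Lemma covector_ext (x : M) (c c' : dual A x) :
  (forall Y, smooth_section Y -> c (Y x) = c' (Y x)) -> c = c'.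
Proof.
move=> cc'; apply/lfunP => v; have [Y sY <-] := fiber_section v; exact: cc'.
Qed.

(** Since [chi x = 1], linearity over functions gives the same value at [x] on Y and on chi^2 Y. The
    latter is a combination of the global sections [E k], so the value at [x] is a linear function
    of the coordinates of Y(x). *)
Lemma covector_ofP (phi : section A -> M -> R) (x : M) :
  (forall f X Y, smooth f -> smooth_section X -> smooth_section Y ->
    phi (fun y => f y *: X y + Y y) x = f x * phi X x + phi Y x) ->
  forall Y, smooth_section Y -> covector_of phi x (Y x) = phi Y x.
Proof.
(* [xget] falls back on its default 0 only when no representing covector exists; the rest of the
   proof constructs one and so excludes that case. *)
move=> phiL; rewrite /covector_of; case: xgetP => [c _ //|nex].
have phi0 : phi (fun y => 0) x = 0.
  have s0 := @smooth_section0 _ _ _ _ A.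
  have /= := phiL (fun=> 1) _ _ (smooth_cst 1) s0 s0.
  have -> : (fun y => 1 *: 0 + 0) = (fun y => 0 : A y).
    by apply: functional_extensionality_dep => y; rewrite scaler0 addr0.
  by rewrite mul1r => /eqP; rewrite -subr_eq subrr => /eqP.
have phi_sum (s : seq 'I_r) (g : 'I_r -> M -> R) (E : 'I_r -> section A) :
    (forall k, smooth (g k)) -> (forall k, smooth_section (E k)) ->
    phi (fun y => \sum_(k <- s) g k y *: E k y) x = \sum_(k <- s) g k x * phi (E k) x.
  move=> sg sE; elim: s => [|k s IH].
    rewrite big_nil -[RHS]phi0; congr phi.
    by apply: functional_extensionality_dep => y; rewrite big_nil.
  rewrite big_cons -IH -phiL //; last first.
    by apply: smooth_section_sum => j; exact: smooth_sectionZ.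
  congr phi; by apply: functional_extensionality_dep => y; rewrite big_cons.
have [chi [E [schi chix bE sE EP]]] := bump_frame A x.
exfalso; pose B := [tuple E k x | k < r].
apply: (nex (\sum_k phi (E k) x *: (dual_frame B)`_k)) => Y sY.
have [g [sg gx gE]] := EP _ sY.
have -> : phi Y x = phi (fun y => (chi y * chi y) *: Y y + 0) x.
  by rewrite phiL ?phi0 ?chix ?mul1r ?addr0 //; [exact: smoothM | exact: smooth_section0].
have -> : (fun y => (chi y * chi y) *: Y y + 0) = (fun y => (chi y * chi y) *: Y y).
  by apply: functional_extensionality_dep => y; rewrite addr0.
rewrite gE phi_sum // sum_lfunE; apply: eq_bigr => k _.
by rewrite scale_lfunE dual_frameE gx mulrC.
Qed.

End Tensoriality.

(** * The bidual, and smooth sections of dual bundles *)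

Section DualSections.
Context (R : realType) (n : nat) (M : manifold R n) (r : nat) (A : vbundle M r).
Implicit Types (W : set M) (X Y : section A) (a : section (dual A)).

Lemma evK (x : M) (v : A x) : (ev A x)^-1%VF (ev A x v) = v.
Proof.
apply: lker0_lfunK; apply/lker0P => u w uw.
have [i ix] := triv_cover A x; have bA := frame_basis ix.
rewrite (coord_basis bA (memvf u)) (coord_basis bA (memvf w)).
apply: eq_bigr => k _; congr (_ *: _).
have /lfunP/(_ (dual_frame (frame A i x))`_k) := uw.
by rewrite !evE !dual_frameE.
Qed.

Lemma evVK (x : M) (c : dual (dual A) x) : ev A x ((ev A x)^-1%VF c) = c.
Proof.
have [i ix] := triv_cover A x; have bA := frame_basis ix.
have bD := dual_frame_basis bA.
suff [v ->] : exists v, c = ev A x v by rewrite evK.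
(* The coordinates of the preimage are the values of [c] on the dual frame. *)
exists (\sum_(k < r) c (dual_frame (frame A i x))`_k *: (frame A i x)`_k).
apply/lfunP => b; rewrite evE [in LHS](coord_basis bD (memvf b)) !linear_sum.
apply: eq_bigr => k _; rewrite !linearZ /= coord_dual_frame //.
exact: mulrC.
Qed.

Lemma evV_pairing (x : M) (c : dual (dual A) x) (b : dual A x) :
  b ((ev A x)^-1%VF c) = c b.
Proof. by rewrite -evE evVK. Qed.

Lemma smooth_section_on_dualP W a : open W ->
  smooth_section_on W a <-> forall (i : triv_idx A) (k : 'I_r),
    smooth_on (W `&` triv_dom A i) (fun x => a x (frame A i x)`_k).
Proof.
move=> oW; split=> sa i k;
  (have o : open (W `&` triv_dom A i) by apply: openI => //; exact: triv_dom_open);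
  apply: smooth_on_ext (sa i k) => // x [_ ix];
  have bA := frame_basis (ix : triv_dom A i x).
  by rewrite coord_dual_frame.
by rewrite coord_dual_frame.
Qed.

Lemma smooth_on_pairing W a X : open W -> smooth_section_on W a ->
  smooth_section_on W X -> smooth_on W (fun x => a x (X x)).
Proof.
move=> oW sa sX; apply: (@smooth_on_triv _ _ _ _ A) => i.
have o : open (W `&` triv_dom A i) by apply: openI => //; exact: triv_dom_open.
move/smooth_section_on_dualP: sa => /(_ oW i) sa.
apply: (smooth_on_ext o (f := fun x =>
    \sum_k coord (frame A i x) k (X x) * a x (frame A i x)`_k)).
  move=> x [_ ix]; rewrite [in RHS](coord_basis (frame_basis ix) (memvf (X x))).
  by rewrite linear_sum; apply: eq_bigr => k _; rewrite linearZ.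
by apply: smooth_on_sum => // k; apply: smooth_onM => //; exact: sX.
Qed.

Lemma smooth_section_on_flat W (w : two_form A) X : open W ->
  smooth_section_on W X -> smooth_section_on W (fun x => w x (X x) : dual A x).
Proof.
move=> oW sX; apply/smooth_section_on_dualP => // i k.
have o : open (W `&` triv_dom A i) by apply: openI => //; exact: triv_dom_open.
apply: (smooth_on_ext o (f := fun x => \sum_l coord (frame A i x) l (X x) *
    w x (frame A i x)`_l (frame A i x)`_k)).
  move=> x [_ ix]; rewrite [in RHS](coord_basis (frame_basis ix) (memvf (X x))).
  rewrite linear_sum sum_lfunE; apply: eq_bigr => l _.
  by rewrite linearZ scale_lfunE.
apply: smooth_on_sum => // l; apply: smooth_onM => //.
by apply: smooth_on_sub (form_smooth w i l k); exact: subIsetr.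
Qed.

Lemma smooth_section_on_ev W X : open W -> smooth_section_on W X ->
  smooth_section_on W (fun x => ev A x (X x)).
Proof.
move=> oW sX i k.
have o : open (W `&` triv_dom A i) by apply: openI => //; exact: triv_dom_open.
apply: smooth_on_ext (sX i k) => // x [_ ix].
have bA := frame_basis ix.
by rewrite coord_dual_frame ?evE ?dual_frameE //; exact: dual_frame_basis.
Qed.

Lemma smooth_section_on_evV W (c : section (dual (dual A))) : open W ->
  smooth_section_on W c ->
  smooth_section_on W (fun x => (ev A x)^-1%VF (c x) : A x).
Proof.
move=> oW sc i k.
have o : open (W `&` triv_dom A i) by apply: openI => //; exact: triv_dom_open.
apply: smooth_on_ext (sc i k) => // x [_ ix].
have bA := @frame_basis _ _ _ _ A i x ix.
rewrite (@coord_dual_frame _ _ _ _ _ _ (dual_frame_basis bA)).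
by rewrite -[RHS]dual_frameE evV_pairing.
Qed.

End DualSections.

Section Bivectors.
Context (R : realType) (n : nat) (M : manifold R n) (r : nat) (A : vbundle M r).
Implicit Types (W : set M) (X Y : section A) (a : section (dual A)).

Lemma smooth_section_on_sharp W (p : bivector A) a : open W ->
  smooth_section_on W a -> smooth_section_on W (fun x => sharp p x (a x) : A x).
Proof.
move=> oW sa.
rewrite (_ : (fun x => _) = (fun x => (ev A x)^-1%VF (p x (a x)) : A x)).
  by apply: smooth_section_on_evV => //; exact: smooth_section_on_flat.
by apply: functional_extensionality_dep => x; rewrite /sharp comp_lfunE.
Qed.

Lemma smooth_pairing a X : smooth_section a -> smooth_section X ->
  smooth (pairing a X).
Proof.
move=> /smooth_sectionE sa /smooth_sectionE sX.
by apply: smooth_on_pairing => //; exact: openT.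
Qed.

Lemma smooth_section_flat (w : two_form A) X : smooth_section X ->
  smooth_section (fun x => w x (X x) : dual A x).
Proof.
move=> /smooth_sectionE sX; apply/smooth_sectionE.
by apply: smooth_section_on_flat => //; exact: openT.
Qed.

Lemma smooth_section_ev X : smooth_section X -> smooth_section (ev_section X).
Proof.
move=> /smooth_sectionE sX; apply/smooth_sectionE.
by apply: smooth_section_on_ev => //; exact: openT.
Qed.

Lemma smooth_section_sharp (p : bivector A) a : smooth_section a ->
  smooth_section (fun x => sharp p x (a x) : A x).
Proof.
move=> /smooth_sectionE sX; apply/smooth_sectionE.
by apply: smooth_section_on_sharp => //; exact: openT.
Qed.

Lemma form_skew (w : two_form A) x (u v : A x) : w x u v = - w x v u.
Proof.
have := form_alt w (u + v); rewrite [w x (u + v)]linearD add_lfunE !linearD /= !form_alt.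
by rewrite add0r addr0 => /eqP; rewrite addr_eq0 => /eqP.
Qed.

Lemma ev_sharp (p : bivector A) x (a : dual A x) : ev A x (sharp p x a) = p x a.
Proof. by rewrite /sharp comp_lfunE evVK. Qed.

Lemma sharp_pairing (p : bivector A) x (a b : dual A x) :
  b (sharp p x a) = p x a b.
Proof. by rewrite /sharp comp_lfunE evV_pairing. Qed.

End Bivectors.

(** * Calculus on a Lie algebroid *)

Section AlgebroidCalculus.
Context (R : realType) (n : nat) (M : manifold R n) (r : nat)
        (A : vbundle M r) (mu : lie_algebroid A).
Implicit Types (f g : M -> R) (X Y Z : section A) (a b : section (dual A)).

Lemma anchorD x (v : A x) (c : R) f g : smooth f -> smooth g ->
  anchor mu x v (fun y => c * f y + g y) = c * anchor mu x v f + anchor mu x v g.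
Proof. by have [add _] := anchor_tangent mu v; exact: add. Qed.

Lemma anchorM x (v : A x) f g : smooth f -> smooth g ->
  anchor mu x v (fun y => f y * g y) = anchor mu x v f * g x + f x * anchor mu x v g.
Proof. by have [_ mul] := anchor_tangent mu v; exact: mul. Qed.

Lemma anchorMD x (v : A x) f g h : smooth f -> smooth g -> smooth h ->
  anchor mu x v (fun y => f y * g y + h y) =
  anchor mu x v f * g x + f x * anchor mu x v g + anchor mu x v h.
Proof.
move=> sf sg sh; rewrite -anchorM //.
rewrite -[X in _ = X + _]mul1r -anchorD //; last exact: smoothM.
by congr anchor; apply/funext => y; rewrite mul1r.
Qed.

Lemma anchor0 x f : smooth f -> anchor mu x 0 f = 0.
Proof.
move=> sf; have := anchor_linear mu 1 (0 : A x) 0 sf.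
by rewrite scaler0 addr0 mul1r => /eqP; rewrite -subr_eq subrr => /eqP.
Qed.

Lemma anchorZ x (c : R) (v : A x) f : smooth f ->
  anchor mu x (c *: v) f = c * anchor mu x v f.
Proof. by move=> sf; rewrite -[c *: v]addr0 anchor_linear // anchor0 // addr0. Qed.

Lemma pairingZD c X Y a :
  pairing a (fun y => c *: X y + Y y) = (fun y => c * pairing a X y + pairing a Y y).
Proof. by apply/funext => y; rewrite /pairing linearP. Qed.

Lemma pairing_funZD f X Y a :
  pairing a (fun y => f y *: X y + Y y) = (fun y => f y * pairing a X y + pairing a Y y).
Proof. by apply/funext => y; rewrite /pairing linearP. Qed.

Lemma pairingZDl c X a b :
  pairing (fun y => c *: a y + b y) X = (fun y => c * pairing a X y + pairing b X y).
Proof. by apply/funext => y; rewrite /pairing add_lfunE scale_lfunE. Qed.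

Lemma lie_brDr X Y Z : smooth_section X -> smooth_section Y ->
  smooth_section Z -> forall x,
  lie_br mu X (fun y => Y y + Z y) x = lie_br mu X Y x + lie_br mu X Z x.
Proof.
move=> sX sY sZ x.
rewrite lie_br_skew //; last exact: smooth_sectionD.
have -> : (fun y => Y y + Z y) = (fun y => 1 *: Y y + Z y).
  by apply: functional_extensionality_dep => y; rewrite scale1r.
rewrite lie_br_linear // scale1r opprD.
by rewrite -lie_br_skew // -lie_br_skew.
Qed.

Lemma lie_br_linear_r c X Y Z : smooth_section X -> smooth_section Y ->
  smooth_section Z -> forall x,
  lie_br mu X (fun y => c *: Y y + Z y) x = c *: lie_br mu X Y x + lie_br mu X Z x.
Proof.
move=> sX sY sZ x; rewrite lie_br_skew //; last exact: smooth_sectionZD.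
by rewrite lie_br_linear // opprD -scalerN -!lie_br_skew.
Qed.

Lemma lie_br_leibnizD f X Y Z : smooth f -> smooth_section X ->
  smooth_section Y -> smooth_section Z -> forall x,
  lie_br mu X (fun y => f y *: Y y + Z y) x =
  f x *: lie_br mu X Y x + anchor mu x (X x) f *: Y x + lie_br mu X Z x.
Proof.
move=> sf sX sY sZ x; rewrite -lie_br_leibniz // lie_brDr //.
exact: smooth_sectionZ.
Qed.

(** When Y is multiplied by f, the term X(f) a(Y) from the product rule cancels the one from the
    Leibniz rule of the bracket. The defining functional is thus linear over functions and
    [covector_ofP] applies; [contr_diffP] rests on the same cancellation. *)
Lemma lie_derP X a Y : smooth_section X -> smooth_section a ->
  smooth_section Y -> forall x, lie_der mu X a x (Y x) =
  anchor_fun mu X (pairing a Y) x - pairing a (lie_br mu X Y) x.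
Proof.
move=> sX sa sY x; apply: covector_ofP sY => f U V sf sU sV.
rewrite /anchor_fun pairing_funZD anchorMD //; try exact: smooth_pairing.
rewrite /pairing lie_br_leibnizD // !linearD /= !linearZ /=.
rewrite /GRing.scale /=; ring.
Qed.

Lemma contr_diffP X a Y : smooth_section X -> smooth_section a ->
  smooth_section Y -> forall x, contr_diff mu X a x (Y x) = diff1 mu a X Y x.
Proof.
move=> sX sa sY x; apply: covector_ofP sY => f U V sf sU sV.
rewrite /diff1 /anchor_fun pairing_funZD anchorMD //; try exact: smooth_pairing.
rewrite anchor_linear; last exact: smooth_pairing.
rewrite /pairing lie_br_leibnizD // !linearD /= !linearZ /=.
rewrite /GRing.scale /=; ring.
Qed.

Lemma lie_der_linear_l c X Y a x : smooth_section X -> smooth_section Y ->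
  smooth_section a ->
  lie_der mu (fun y => c *: X y + Y y) a x = c *: lie_der mu X a x + lie_der mu Y a x.
Proof.
move=> sX sY sa; apply: covector_ext => Z sZ.
have sXY := smooth_sectionZD c sX sY.
rewrite add_lfunE scale_lfunE !lie_derP // /anchor_fun.
rewrite anchor_linear; last exact: smooth_pairing.
rewrite /pairing lie_br_linear // [a x _]linearP /= /GRing.scale /=; ring.
Qed.

Lemma lie_der_linear_r c X a b x : smooth_section X -> smooth_section a ->
  smooth_section b ->
  lie_der mu X (fun y => c *: a y + b y) x = c *: lie_der mu X a x + lie_der mu X b x.
Proof.
move=> sX sa sb; apply: covector_ext => Z sZ.
have sab := smooth_sectionZD c sa sb.
rewrite add_lfunE scale_lfunE !lie_derP // /anchor_fun !pairingZDl.
rewrite anchorD; try exact: smooth_pairing.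
rewrite /GRing.scale /=; ring.
Qed.

Lemma contr_diff_linear_l c X Y a x : smooth_section X -> smooth_section Y ->
  smooth_section a ->
  contr_diff mu (fun y => c *: X y + Y y) a x =
  c *: contr_diff mu X a x + contr_diff mu Y a x.
Proof.
move=> sX sY sa; apply: covector_ext => Z sZ.
have sXY := smooth_sectionZD c sX sY.
rewrite add_lfunE scale_lfunE !contr_diffP // /diff1 /anchor_fun.
rewrite anchor_linear ?pairingZD ?anchorD; try exact: smooth_pairing.
rewrite /pairing lie_br_linear // [a x _]linearP /= /GRing.scale /=; ring.
Qed.

Lemma contr_diff_linear_r c X a b x : smooth_section X -> smooth_section a ->
  smooth_section b ->
  contr_diff mu X (fun y => c *: a y + b y) x =
  c *: contr_diff mu X a x + contr_diff mu X b x.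
Proof.
move=> sX sa sb; apply: covector_ext => Z sZ.
have sab := smooth_sectionZD c sa sb.
rewrite add_lfunE scale_lfunE !contr_diffP // /diff1 /anchor_fun !pairingZDl.
rewrite !anchorD; try exact: smooth_pairing.
rewrite /GRing.scale /=; ring.
Qed.

(* Represents [i_Y i_X dw]. *)
Definition diff2_covector (w : two_form A) X Y : section (dual A) := fun x =>
  lie_der mu X (fun y => w y (Y y) : dual A y) x
  - contr_diff mu Y (fun y => w y (X y) : dual A y) x - w x (lie_br mu X Y x).

(** This combines i_X d = L_X - d i_X with i_Y L_X = L_X i_Y - i_[X,Y]; skew-symmetry of [w]
    accounts for the order of the arguments in [diff2]. *)
Lemma diff2_covectorP (w : two_form A) X Y Z x : smooth_section X ->
  smooth_section Y -> smooth_section Z ->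
  diff2_covector w X Y x (Z x) = diff2 mu w X Y Z x.
Proof.
move=> sX sY sZ; have sw := smooth_section_flat w.
rewrite /diff2_covector !add_lfunE !opp_lfunE lie_derP ?contr_diffP //; try exact: sw.
rewrite /diff1 /diff2 /pairing /anchor_fun.
rewrite [w x (lie_br mu X Z x) (Y x)]form_skew [w x (lie_br mu Y Z x) (X x)]form_skew.
by ring.
Qed.

Lemma diff2_covector_eq0 (w : two_form A) :
  (forall X Y, smooth_section X -> smooth_section Y ->
     forall x, diff2_covector w X Y x = 0) <->
  (forall X Y Z, smooth_section X -> smooth_section Y -> smooth_section Z ->
     forall x, diff2 mu w X Y Z x = 0).
Proof.
split=> [d0 X Y Z sX sY sZ x|d0 X Y sX sY x].
  by rewrite -diff2_covectorP // d0 // zero_lfunE.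
by apply: covector_ext => Z sZ; rewrite diff2_covectorP // d0 // zero_lfunE.
Qed.

End AlgebroidCalculus.

(** * Torsion and second deformation *)

(** Reduces an identity between vectors to scalar identities, which [ring] decides. *)
Lemma functional_ext (K : fieldType) (V : vectType K) (u v : V) :
  (forall phi : 'Hom(V, K^o), phi u = phi v) -> u = v.
Proof.
move=> uv; rewrite (coord_vbasis (memvf u)) (coord_vbasis (memvf v)).
apply: eq_bigr => k _; congr (_ *: _).
have := uv (linfun (coord (vbasis fullv) k : V -> K^o)).
by rewrite !lfunE.
Qed.

Section TorsionIdentities.
Context (K : fieldType) (V : vectType K) (S : 'End(V)) (eps : K).
Context (SS : forall u, S (S u) = eps *: u).

(** Here and in the identities below, [a], [b], [c], [d] stand for the brackets [S e1, S e2],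
    [S e1, e2], [e1, S e2], [e1, e2]; primed letters belong to a second pair of sections. *)
Lemma deform2_identity (a b c d : V) :
  eps *: d + a - S b + (a + eps *: d - S c) - S (b + c - S d) =
  eps *: d + (a - S (b + c) + eps *: d) *+ 2.
Proof.
rewrite !linearD linearN /= !SS; move: (S b) (S c) (eps *: d) => u v w.
by apply: functional_ext => phi; rewrite !(mulr2n, linearD, linearN) /=; ring.
Qed.

Lemma torsion_linear_identity (k : K) (a b c d a' b' c' d' : V) :
  k *: a + a' - S ((k *: b + b') + (k *: c + c')) + eps *: (k *: d + d') =
  k *: (a - S (b + c) + eps *: d) + (a' - S (b' + c') + eps *: d').
Proof.
rewrite !linearD !linearZ /=; move: (S b) (S c) (S b') (S c') => u v u' v'.
apply: functional_ext => phi.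
by rewrite !(linearD, linearN, linearZ) /= /GRing.scale /=; ring.
Qed.

Lemma torsion_Sl_identity (a b c d : V) :
  eps *: c - S (eps *: d + a) + eps *: b = - S (a - S (b + c) + eps *: d).
Proof.
rewrite !(linearD, linearN) /= !linearZ /= !SS; move: (S a) (S d) => u v.
apply: functional_ext => phi.
by rewrite !(linearD, linearN, linearZ) /= /GRing.scale /=; ring.
Qed.

Lemma torsion_Sr_identity (a b c d : V) :
  eps *: b - S (a + eps *: d) + eps *: c = - S (a - S (b + c) + eps *: d).
Proof. by rewrite [a + _]addrC [b + c]addrC torsion_Sl_identity. Qed.

End TorsionIdentities.

(** * Nijenhuis torsion of an endomorphism whose square is a scalar *)

Section Torsion.
Context (R : realType) (n : nat) (M : manifold R n) (r : nat) (E : vbundle M r).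

(** Linearity is over constants only, since the Dorfman bracket obeys Leibniz rules with respect to
    functions. *)
Definition bilinear_bracket (br : section E -> section E -> section E) : Prop :=
  (forall (c : R) e1 e2 e, smooth_section e1 -> smooth_section e2 ->
     smooth_section e -> forall x,
     br (fun y => c *: e1 y + e2 y) e x = c *: br e1 e x + br e2 e x) /\
  (forall (c : R) e1 e2 e, smooth_section e1 -> smooth_section e2 ->
     smooth_section e -> forall x,
     br e (fun y => c *: e1 y + e2 y) x = c *: br e e1 x + br e e2 x).

Section Bilinear.
Context (br : section E -> section E -> section E).
Context (brP : bilinear_bracket br).
Implicit Types e : section E.

Lemma bracket0l e : smooth_section e -> forall x, br (fun y => 0) e x = 0.
Proof.
move=> se x; have s0 := @smooth_section0 _ _ _ _ E.
have := brP.1 1 _ _ _ s0 s0 se x.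
have -> : (fun y => 1 *: 0 + 0) = (fun y => 0 : E y).
  by apply: functional_extensionality_dep => y; rewrite scaler0 addr0.
by rewrite scale1r => /eqP; rewrite -subr_eq subrr => /eqP.
Qed.

Lemma bracket0r e : smooth_section e -> forall x, br e (fun y => 0) x = 0.
Proof.
move=> se x; have s0 := @smooth_section0 _ _ _ _ E.
have := brP.2 1 _ _ _ s0 s0 se x.
have -> : (fun y => 1 *: 0 + 0) = (fun y => 0 : E y).
  by apply: functional_extensionality_dep => y; rewrite scaler0 addr0.
by rewrite scale1r => /eqP; rewrite -subr_eq subrr => /eqP.
Qed.

Lemma bracketZl (c : R) e1 e : smooth_section e1 -> smooth_section e ->
  forall x, br (fun y => c *: e1 y) e x = c *: br e1 e x.
Proof.
move=> se1 se x; have s0 := @smooth_section0 _ _ _ _ E.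
have := brP.1 c _ _ _ se1 s0 se x; rewrite bracket0l // addr0 => <-.
have -> // : (fun y => c *: e1 y) = (fun y => c *: e1 y + 0).
by apply: functional_extensionality_dep => y; rewrite addr0.
Qed.

Lemma bracketZr (c : R) e1 e : smooth_section e1 -> smooth_section e ->
  forall x, br e (fun y => c *: e1 y) x = c *: br e e1 x.
Proof.
move=> se1 se x; have s0 := @smooth_section0 _ _ _ _ E.
have := brP.2 c _ _ _ se1 s0 se x; rewrite bracket0r // addr0 => <-.
have -> // : (fun y => c *: e1 y) = (fun y => c *: e1 y + 0).
by apply: functional_extensionality_dep => y; rewrite addr0.
Qed.

End Bilinear.

Context (T : courant_data E) (S : forall x : M, 'End(E x)) (eps : R).
Context (TP : bilinear_bracket (dorfman T)).
Context (S_smooth : forall e : section E, smooth_section e ->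
  smooth_section (fun y => S y (e y))).
Context (SS : forall x u, S x (S x u) = eps *: u).
Implicit Types e : section E.

(** The Nijenhuis torsion of [S], with S^2 already replaced by [eps]. *)
Definition torsion e1 e2 : section E := fun x =>
  dorfman T (fun y => S y (e1 y)) (fun y => S y (e2 y)) x
  - S x (dorfman T (fun y => S y (e1 y)) e2 x
         + dorfman T e1 (fun y => S y (e2 y)) x)
  + eps *: dorfman T e1 e2 x.

Lemma SS_section e : (fun y => S y (S y (e y))) = (fun y => eps *: e y).
Proof. by apply: functional_extensionality_dep => y; rewrite SS. Qed.

Lemma deform2E e1 e2 x : smooth_section e1 -> smooth_section e2 ->
  dorfman (deform (deform T S) S) e1 e2 x =
  eps *: dorfman T e1 e2 x + torsion e1 e2 x *+ 2.
Proof.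
move=> s1 s2; have [sS1 sS2] := (S_smooth s1, S_smooth s2).
rewrite /= !SS_section (bracketZl TP) // (bracketZr TP) // /torsion.
exact: (deform2_identity (@SS x)).
Qed.

Lemma torsion_linear_l (c : R) e1 e2 e x : smooth_section e1 ->
  smooth_section e2 -> smooth_section e ->
  torsion (fun y => c *: e1 y + e2 y) e x = c *: torsion e1 e x + torsion e2 e x.
Proof.
move=> s1 s2 s; have [[sS1 sS2] sS] := (S_smooth s1, S_smooth s2, S_smooth s).
rewrite /torsion.
have -> : (fun y => S y (c *: e1 y + e2 y)) = (fun y => c *: S y (e1 y) + S y (e2 y)).
  by apply: functional_extensionality_dep => y; rewrite linearP.
rewrite !TP.1 //.
exact: torsion_linear_identity.
Qed.

Lemma torsion_linear_r (c : R) e1 e2 e x : smooth_section e1 ->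
  smooth_section e2 -> smooth_section e ->
  torsion e (fun y => c *: e1 y + e2 y) x = c *: torsion e e1 x + torsion e e2 x.
Proof.
move=> s1 s2 s; have [[sS1 sS2] sS] := (S_smooth s1, S_smooth s2, S_smooth s).
rewrite /torsion.
have -> : (fun y => S y (c *: e1 y + e2 y)) = (fun y => c *: S y (e1 y) + S y (e2 y)).
  by apply: functional_extensionality_dep => y; rewrite linearP.
rewrite !TP.2 //.
exact: torsion_linear_identity.
Qed.

Lemma torsion_Sl e1 e2 x : smooth_section e1 -> smooth_section e2 ->
  torsion (fun y => S y (e1 y)) e2 x = - S x (torsion e1 e2 x).
Proof.
move=> s1 s2; have [sS1 sS2] := (S_smooth s1, S_smooth s2).
rewrite /torsion !SS_section !(bracketZl TP) //.
exact: (torsion_Sl_identity (@SS x)).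
Qed.

Lemma torsion_Sr e1 e2 x : smooth_section e1 -> smooth_section e2 ->
  torsion e1 (fun y => S y (e2 y)) x = - S x (torsion e1 e2 x).
Proof.
move=> s1 s2; have [sS1 sS2] := (S_smooth s1, S_smooth s2).
rewrite /torsion !SS_section !(bracketZr TP) //.
exact: (torsion_Sr_identity (@SS x)).
Qed.

End Torsion.

(** * The bracket of the double *)

Section WhitneySum.
Context (R : realType) (n : nat) (M : manifold R n) (r s : nat)
        (A : vbundle M r) (B : vbundle M s).

Lemma smooth_section_on_whitney (W : set M) (e : section (whitney_sum A B)) :
  open W -> smooth_section_on W e <->
  smooth_section_on W (fun x => (e x).1 : A x) /\
  smooth_section_on W (fun x => (e x).2 : B x).
Proof.
move=> oW; have coordE (i : triv_idx A) (j : triv_idx B) k x : triv_dom A i x -> triv_dom B j x ->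
    coord (frame (whitney_sum A B) (i, j) x) k (e x) =
    match fintype.split k with inl k => coord (frame A i x) k (e x).1
                     | inr k => coord (frame B j x) k (e x).2 end.
  by move=> ix jx; exact: (coord_sum_frame (frame_basis ix) (frame_basis jx)).
split=> [se|[s1 s2]].
  split=> [i k|j k].
    (* The sum is trivialised by pairs, so a trivialisation of the other summand is chosen locally
       before the component is read off. *)
    apply: (@smooth_on_triv _ _ _ _ B) => j.
    apply: (smooth_on_ext _ _ (smooth_on_sub _ (se (i, j) (lshift s k)))).
    - by apply: openI; [apply: openI => //|]; exact: triv_dom_open.
    - by move=> x [[_ ix] jx]; rewrite coordE // (unsplitK (inl k)).
    - by move=> x [[Wx ix] jx].
  apply: (@smooth_on_triv _ _ _ _ A) => i.
  apply: (smooth_on_ext _ _ (smooth_on_sub _ (se (i, j) (rshift r k)))).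
  - by apply: openI; [apply: openI => //|]; exact: triv_dom_open.
  - by move=> x [[_ jx] ix]; rewrite coordE // (unsplitK (inr k)).
  - by move=> x [[Wx jx] ix].
move=> [i j] k; have o : open (W `&` triv_dom (whitney_sum A B) (i, j)).
  by apply: openI => //; exact: triv_dom_open.
apply: (@smooth_on_ext _ _ _ _ (fun x =>
    match fintype.split k with inl k => coord (frame A i x) k (e x).1
                     | inr k => coord (frame B j x) k (e x).2 end)) => //.
  by move=> x [_ [ix jx]]; rewrite coordE.
case: (fintype.split k) => l.
  by apply: smooth_on_sub (s1 i l) => x [Wx [ix jx]].
by apply: smooth_on_sub (s2 j l) => x [Wx [ix jx]].
Qed.

Lemma smooth_section_whitney (e : section (whitney_sum A B)) :
  smooth_section e <->
  smooth_section (fun x => (e x).1 : A x) /\ smooth_section (fun x => (e x).2 : B x).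
Proof.
rewrite !smooth_sectionE; apply: smooth_section_on_whitney; exact: openT.
Qed.

End WhitneySum.

Section ZeroSections.
Context (R : realType) (n : nat) (M : manifold R n) (r : nat)
        (A : vbundle M r) (mu : lie_algebroid A).
Implicit Types (X Y : section A) (a : section (dual A)).

Let s0 (s : nat) (B : vbundle M s) := @smooth_section0 _ _ _ _ B.

Lemma zero_combination (s : nat) (B : vbundle M s) :
  (fun y => 1 *: 0 + 0) = (fun y => 0 : B y).
Proof. by apply: functional_extensionality_dep => y; rewrite scaler0 addr0. Qed.

(** Each operation below is linear; evaluated on zero sections, its linearity rule takes the form of
    this hypothesis. *)
Lemma idempotent0 (V : lmodType R) (v : V) : v = 1 *: v + v -> v = 0.
Proof. by rewrite scale1r => /eqP; rewrite -subr_eq subrr => /eqP. Qed.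

Lemma lie_br0l Y x : smooth_section Y -> lie_br mu (fun y => 0) Y x = 0.
Proof.
move=> sY; apply: idempotent0.
by rewrite -(lie_br_linear mu 1 (@s0 _ A) (@s0 _ A) sY) zero_combination.
Qed.

Lemma lie_br0r Y x : smooth_section Y -> lie_br mu Y (fun y => 0) x = 0.
Proof.
move=> sY; apply: idempotent0.
by rewrite -(lie_br_linear_r mu 1 sY (@s0 _ A) (@s0 _ A)) zero_combination.
Qed.

Lemma lie_der0l a x : smooth_section a -> lie_der mu (fun y => 0) a x = 0.
Proof.
move=> sa; apply: idempotent0.
by rewrite -(lie_der_linear_l mu 1 x (@s0 _ A) (@s0 _ A) sa) zero_combination.
Qed.

Lemma lie_der0r X x : smooth_section X -> lie_der mu X (fun y => 0) x = 0.
Proof.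
move=> sX; apply: idempotent0.
by rewrite -(lie_der_linear_r mu 1 x sX (@s0 _ _) (@s0 _ _)) zero_combination.
Qed.

Lemma contr_diff0l a x : smooth_section a -> contr_diff mu (fun y => 0) a x = 0.
Proof.
move=> sa; apply: idempotent0.
by rewrite -(contr_diff_linear_l mu 1 x (@s0 _ A) (@s0 _ A) sa) zero_combination.
Qed.

Lemma contr_diff0r X x : smooth_section X -> contr_diff mu X (fun y => 0) x = 0.
Proof.
move=> sX; apply: idempotent0.
by rewrite -(contr_diff_linear_r mu 1 x sX (@s0 _ _) (@s0 _ _)) zero_combination.
Qed.

End ZeroSections.

Section LinearSums.
Context (K : fieldType) (V U : vectType K) (f : 'Hom(V, U)) (c : K).

Lemma bracket_sum_r (p p' l l' m m' : V) :
  (c *: p + p') + (c *: l + l') - (c *: m + m') =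
  c *: (p + l - m) + (p' + l' - m').
Proof. by rewrite addrACA -scalerDr opprD addrACA -scalerBr. Qed.

Lemma bracket_sum_l (p p' : U) (l l' m m' : V) :
  (c *: p + p') + f ((c *: l + l') - (c *: m + m')) =
  c *: (p + f (l - m)) + (p' + f (l' - m')).
Proof. by rewrite opprD addrACA -scalerBr linearP addrACA -scalerDr. Qed.

End LinearSums.

Section DoubleBracket.
Context (R : realType) (n : nat) (M : manifold R n) (r : nat)
        (A : vbundle M r) (mu : lie_algebroid A) (gamma : lie_algebroid (dual A)).
Implicit Types (X Y : section A) (a b : section (dual A)).

Definition double_section X a : section (double_bundle A) := fun x => (X x, a x).

Lemma double_sectionE (e : section (double_bundle A)) :
  e = double_section (fun x => (e x).1) (fun x => (e x).2).
Proof.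
by apply: functional_extensionality_dep => x; rewrite /double_section; case: (e x).
Qed.

Lemma smooth_double_section X a : smooth_section X -> smooth_section a ->
  smooth_section (double_section X a).
Proof. by move=> sX sa; apply/smooth_section_whitney; split. Qed.

Lemma double_section_ind (P : section (double_bundle A) -> Prop) :
  (forall X a, smooth_section X -> smooth_section a -> P (double_section X a)) ->
  forall e, smooth_section e -> P e.
Proof.
move=> PXa e se; have /smooth_section_whitney[s1 s2] := se.
by rewrite (double_sectionE e); exact: PXa.
Qed.

Lemma double_dorfmanE X a Y b x :
  dorfman (double_courant mu gamma) (double_section X a) (double_section Y b) x =
  (lie_br mu X Y x + (ev A x)^-1%VF (lie_der gamma a (ev_section Y) x
                         - contr_diff gamma b (ev_section X) x),
   lie_br gamma a b x + lie_der mu X b x - contr_diff mu Y a x).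
Proof. by []. Qed.

Lemma ev_sectionZD c X Y :
  ev_section (fun y => c *: X y + Y y) =
  (fun y => c *: ev_section X y + ev_section Y y).
Proof. by apply: functional_extensionality_dep => y; rewrite /ev_section linearP. Qed.

Lemma ev_section0 : ev_section (fun y => 0 : A y) = (fun y => 0).
Proof. by apply: functional_extensionality_dep => y; rewrite /ev_section linear0. Qed.

Lemma double_sectionZD c X a Y b :
  (fun y => c *: double_section X a y + double_section Y b y) =
  double_section (fun y => c *: X y + Y y) (fun y => c *: a y + b y).
Proof. by []. Qed.

Lemma pairZD (U V : lmodType R) (c : R) (u u' : U) (v v' : V) :
  c *: (u, v) + (u', v') = (c *: u + u', c *: v + v').
Proof. by []. Qed.

Lemma double_bilinear : bilinear_bracket (dorfman (double_courant mu gamma)).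
Proof.
split=> c e1 e2 e; elim/double_section_ind: e1 / => X a sX sa;
  elim/double_section_ind => X' a' sX' sa'; elim/double_section_ind => Y b sY sb x;
  rewrite double_sectionZD !double_dorfmanE ev_sectionZD pairZD;
  have [[sX1 sX2] sY1] :=
    (smooth_section_ev sX, smooth_section_ev sX', smooth_section_ev sY).
  rewrite !lie_br_linear // !lie_der_linear_l // !contr_diff_linear_r //.
  by congr pair; [exact: bracket_sum_l | exact: bracket_sum_r].
rewrite !lie_br_linear_r // !lie_der_linear_r // !contr_diff_linear_l //.
by congr pair; [exact: bracket_sum_l | exact: bracket_sum_r].
Qed.

Section SmoothEndo.
Context (c : R) (w : two_form A) (p : bivector A).

Lemma double_endo_section X a :
  (fun x => double_endo c w p x (double_section X a x)) =
  double_section (fun x => c *: sharp p x (a x)) (fun x => w x (X x)).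
Proof. by apply: functional_extensionality_dep => x; rewrite double_endoE. Qed.

Lemma smooth_section_on_double_endo (W : set M) (e : section (double_bundle A)) :
  open W -> smooth_section_on W e ->
  smooth_section_on W (fun x => double_endo c w p x (e x)).
Proof.
move=> oW /(smooth_section_on_whitney _ oW)[s1 s2].
rewrite (double_sectionE e) double_endo_section.
apply/smooth_section_on_whitney => //; split; last exact: smooth_section_on_flat.
apply: smooth_section_onZ => //; first exact: smooth_on_cst.
exact: smooth_section_on_sharp.
Qed.

Lemma smooth_section_double_endo (e : section (double_bundle A)) :
  smooth_section e -> smooth_section (fun x => double_endo c w p x (e x)).
Proof.
move=> /smooth_sectionE se; apply/smooth_sectionE.
by apply: smooth_section_on_double_endo => //; exact: openT.
Qed.

(** The matrix entries are coordinates of images of frame sections. These are controlled only over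
    their own trivialisation, which is why smoothness of sections is carried relative to an open
    set. *)
Lemma double_endo_smooth : smooth_endo (double_endo c w p).
Proof.
move=> i k l; have oi := @triv_dom_open _ _ _ _ (double_bundle A) i.
have := smooth_section_on_double_endo oi (frame_smooth_section_on i l).
by move=> /(_ i k); rewrite setIid.
Qed.

Lemma double_endo_skew : skew_endo (@double_form R n M r A) (double_endo c w p).
Proof.
move=> x u v; rewrite !double_endoE /double_form /= !linearZ /= !sharp_pairing.
rewrite (form_skew w) (form_skew p) /GRing.scale /=; ring.
Qed.

End SmoothEndo.

Section InversePair.
Context (eps : R) (w : two_form A) (p : bivector A).
Context (eps2 : eps * eps = 1).
Context (pw : forall x v, sharp p x (w x v) = v).
Context (wp : forall x (a : dual A x), w x (sharp p x a) = a).

Local Notation T := (double_courant mu gamma).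
Local Notation S := (double_endo eps w p).

Lemma double_endo2 x u : S x (S x u) = eps *: u.
Proof. by case: u => v a; rewrite !double_endoE /= linearZ /= pw wp. Qed.

(** [S] sends (X, 0) to (0, w X). The two mixed brackets then supply the Lie derivatives and
    contractions of both algebroids, while [X, Y] and [w X, w Y] fit in as p(w [X, Y]) and w(p
    [w X, w Y]). *)
Lemma torsion_horizontal X Y x : smooth_section X -> smooth_section Y ->
  torsion T S eps (double_section X (fun y => 0)) (double_section Y (fun y => 0)) x =
  (- (eps *: sharp p x (diff2_covector mu w X Y x)),
   - w x ((ev A x)^-1%VF (diff2_covector gamma p
       (fun y => w y (X y) : dual A y) (fun y => w y (Y y) : dual A y) x))).
Proof.
move=> sX sY; have s0 := @smooth_section0 _ _ _ _ A.
have s0' := @smooth_section0 _ _ _ _ (dual A).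
have [swX swY] := (smooth_section_flat w sX, smooth_section_flat w sY).
have [seX seY] := (smooth_section_ev sX, smooth_section_ev sY).
have s0'' := @smooth_section0 _ _ _ _ (dual (dual A)).
have SE Z : (fun y => S y (double_section Z (fun y => 0) y)) =
    double_section (fun y => 0) (fun y => w y (Z y)).
  rewrite double_endo_section; congr double_section.
  by apply: functional_extensionality_dep => y; rewrite linear0 scaler0.
(* The covectors that enter [diff2_covector gamma p] at w X and w Y are thus X and Y seen in the
   bidual, as in the Dorfman bracket. *)
have evE Z : (fun y => p y (w y (Z y))) = ev_section Z.
  by apply: functional_extensionality_dep => y; rewrite -ev_sharp pw.
rewrite /torsion !SE !double_dorfmanE !ev_section0.
rewrite !(lie_br0l, lie_br0r, lie_der0l, lie_der0r, contr_diff0l, contr_diff0r) //.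
rewrite !(subrr, subr0, sub0r, add0r, addr0, linear0) double_endoE /=.
rewrite /diff2_covector !evE !(linearB, linearD, linearN) /= pw.
rewrite -[p x (lie_br gamma _ _ x)]ev_sharp evK wp.
congr pair.
  rewrite -[LHS]/(0 - (- _ + _) + eps *: _) sub0r opprD !opprK.
  by congr (_ + _); rewrite addrC.
rewrite -[LHS]/(_ - (_ - _) + eps *: 0) scaler0 addr0 opprD !opprK.
by rewrite addrC.
Qed.

Lemma torsion_eq0P :
  (forall e1 e2, smooth_section e1 -> smooth_section e2 ->
     forall x, torsion T S eps e1 e2 x = 0) <->
  (forall X Y, smooth_section X -> smooth_section Y ->
     forall x, diff2_covector mu w X Y x = 0) /\
  (forall a b, smooth_section a -> smooth_section b ->
     forall x, diff2_covector gamma p a b x = 0).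
Proof.
have eps0 : eps != 0.
  by apply: contra_eq_neq eps2 => ->; rewrite mul0r eq_sym oner_neq0.
have s0 := @smooth_section0 _ _ _ _ A.
have s0' := @smooth_section0 _ _ _ _ (dual A).
have wpE (a : section (dual A)) : (fun y => w y (sharp p y (a y))) = a.
  by apply: functional_extensionality_dep => y; rewrite wp.
split=> [t0|[dw dp] e1 e2].
  have h0 X Y (sX : smooth_section X) (sY : smooth_section Y) x :=
    t0 _ _ (smooth_double_section sX s0') (smooth_double_section sY s0') x.
  split=> [X Y sX sY x|a b sa sb x].
    have := h0 X Y sX sY x; rewrite torsion_horizontal // => -[/eqP + _].
    rewrite oppr_eq0 scaler_eq0 (negPf eps0) /= => /eqP s_eq0.
    by rewrite -(wp (diff2_covector mu w X Y x)) s_eq0 linear0.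
  (* Arbitrary sections a and b of the dual are w X and w Y for X = p a and Y = p b. *)
  have sXa := smooth_section_sharp p sa; have sYb := smooth_section_sharp p sb.
  have := h0 _ _ sXa sYb x; rewrite torsion_horizontal // !wpE => -[_ /eqP].
  rewrite oppr_eq0 => /eqP w_eq0.
  by rewrite -(evVK (diff2_covector _ _ _ _ _)) -(pw (_^-1%VF _)) w_eq0 !linear0.
(* (X, a) = S (p a, 0) + (X, 0), so bilinearity and the rules for [S] reduce the torsion to sections
   of [A]. The coefficient 1 matches the shape of the linearity lemmas. *)
have split_section X a : double_section X a = (fun y =>
    1 *: S y (double_section (fun z => sharp p z (a z)) (fun z => 0) y)
    + double_section X (fun z => 0) y).
  apply: functional_extensionality_dep => y.
  rewrite double_endoE /double_section scale1r /= linear0 scaler0 wp.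
  by rewrite -[RHS]/(_ + _, _ + _) add0r addr0.
have tS := torsion_linear_l eps double_bilinear (@smooth_section_double_endo eps w p).
have tS' := torsion_linear_r eps double_bilinear (@smooth_section_double_endo eps w p).
have h0 X Y x : smooth_section X -> smooth_section Y ->
    torsion T S eps (double_section X (fun=> 0)) (double_section Y (fun=> 0)) x = 0.
  move=> sX sY; rewrite torsion_horizontal // dw // dp ?linear0 ?scaler0 ?oppr0 //;
    exact: smooth_section_flat.
have sE := @smooth_section_double_endo eps w p.
have t_Sl := torsion_Sl double_bilinear sE double_endo2.
have t_Sr := torsion_Sr double_bilinear sE double_endo2.
elim/double_section_ind: e1 / => X a sX sa.
elim/double_section_ind => Y b sY sb x.
have sXa := smooth_double_section sX sa.
have sYb := smooth_double_section sY sb.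
have [spa spb] := (smooth_section_sharp p sa, smooth_section_sharp p sb).
have [sX0 sY0] := (smooth_double_section sX s0', smooth_double_section sY s0').
have [sa0 sb0] := (smooth_double_section spa s0', smooth_double_section spb s0').
have [sSa sSb] := (sE _ sa0, sE _ sb0).
rewrite (split_section X) tS // (split_section Y) !tS' //.
rewrite !t_Sl // !t_Sr // !h0 //.
by rewrite !(linear0, oppr0, scaler0, addr0).
Qed.

End InversePair.
End DoubleBracket.

(** * Linear algebra of inverse pairs *)

Lemma comp_square_lfunE (K : fieldType) (V W : vectType K) (f : 'Hom(W, V))
    (g : 'Hom(V, W)) (v : V) :
  ((f \o g) \o (f \o g))%VF v = f (g (f (g v))).
Proof. by rewrite !comp_lfunE. Qed.

Section InversePairs.
Context (K : fieldType) (V W : vectType K).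
Context (w1 w2 : 'Hom(V, W)) (p1 p2 : 'Hom(W, V)) (eps : K).
Context (pw1 : cancel w1 p1) (wp1 : cancel p1 w1).
Context (pw2 : cancel w2 p2) (wp2 : cancel p2 w2).

(** The map p2 w1 is inverse to p1 w2, and a square equals [eps] exactly when the map is [eps] times
    its inverse. *)
Lemma recursion_sqP :
  (forall v, p1 (w2 (p1 (w2 v))) = eps *: v) <->
  (forall v, p1 (w2 v) = eps *: p2 (w1 v)).
Proof.
split=> [sq v|comm v]; last by rewrite comm wp1 pw2.
by rewrite -sq wp2 pw1.
Qed.

(** Conjugation by [w2] carries the relation from [V] to [W], that is, from the algebroid to its
    dual. *)
Lemma recursion_dual : (forall v, p1 (w2 v) = eps *: p2 (w1 v)) ->
  forall a, w2 (p1 a) = eps *: w1 (p2 a).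
Proof.
by move=> comm a; rewrite -[in LHS](wp2 a) comm linearZ /= wp2.
Qed.

End InversePairs.

(** * A 2-form viewed as a bivector on the dual bundle *)

Section Bidual.
Context (R : realType) (n : nat) (M : manifold R n) (r : nat) (A : vbundle M r)
        (w : two_form A).

Lemma ev_frame (i : triv_idx A) (x : M) (k : 'I_r) : triv_dom A i x ->
  ev A x (frame A i x)`_k = (frame (dual (dual A)) i x)`_k.
Proof.
move=> ix; apply/lfunP => b; rewrite evE dual_frameE coord_dual_frame //.
exact: frame_basis.
Qed.

(** An inverse bivector on [dual A] is encoded as a 2-form on its dual, so [w] has to be transported
    along [ev] to the bidual. *)
Definition bidual_flat (x : M) : 'Hom(dual (dual A) x, dual (dual (dual A)) x) :=
  (ev (dual A) x \o (flat w x \o (ev A x)^-1))%VF.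

Lemma bidual_flatE x (c d : dual (dual A) x) :
  bidual_flat x c d = w x ((ev A x)^-1%VF c) ((ev A x)^-1%VF d).
Proof. by rewrite /bidual_flat !comp_lfunE evE -evV_pairing. Qed.

Lemma bidual_alt x (c : dual (dual A) x) : bidual_flat x c c = 0.
Proof. by rewrite bidual_flatE form_alt. Qed.

Lemma bidual_smooth (i : triv_idx (dual (dual A))) (k l : 'I_r) :
  smooth_on (triv_dom (dual (dual A)) i) (fun x => bidual_flat x
    (frame (dual (dual A)) i x)`_k (frame (dual (dual A)) i x)`_l).
Proof.
apply: (smooth_on_ext _ _ (form_smooth w i k l)); first exact: triv_dom_open.
by move=> x ix; rewrite bidual_flatE -!ev_frame // !evK.
Qed.

Definition bidual_form : bivector (dual A) := TwoForm bidual_alt bidual_smooth.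

Lemma sharp_bidual x (c : dual (dual A) x) :
  sharp bidual_form x c = w x ((ev A x)^-1%VF c).
Proof.
have E : bidual_form x c = ev (dual A) x (w x ((ev A x)^-1%VF c)).
  by rewrite -[LHS]/(bidual_flat x c) /bidual_flat !comp_lfunE.
by rewrite /sharp comp_lfunE E evK.
Qed.

End Bidual.

Section Inverse.
Context (R : realType) (n : nat) (M : manifold R n) (r : nat) (A : vbundle M r).

(** The fibres of [A] and of its dual have the same dimension, so the one-sided condition gives both
    cancellations. *)
Lemma is_inverseP (p : bivector A) (w : two_form A) : is_inverse p w <->
  forall x, cancel (flat w x) (sharp p x) /\ cancel (sharp p x) (flat w x).
Proof.
split=> [pw x|pw x]; last first.
  by apply/lfunP => v; rewrite comp_lfunE id_lfunE (pw x).1.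
have wp := lfun_inverse_sym (etrans (fiber_dim A x) (esym (fiber_dim (dual A) x))) (pw x).
by split=> v; rewrite -comp_lfunE ?pw ?wp id_lfunE.
Qed.

Lemma nondegenerate_cancel (w : two_form A) (p : bivector A) x :
  cancel (flat w x) (sharp p x) -> lker (flat w x) == 0%VS.
Proof. by move=> pw; apply/lker0P; exact: can_inj pw. Qed.

End Inverse.

(** * Cyclic indices *)

Section Z3.

(** [k] is the remaining index; distinct indices are its two neighbours in some order, as in the
    indexing of N_k. *)
Lemma Z3_pairs (i j : 'Z_3) : i != j ->
  exists k, (i = k - 1 /\ j = k + 1) \/ (i = k + 1 /\ j = k - 1).
Proof.
case: i j => -[|[|[|//]]] hi [[|[|[|//]]] hj] //= _;
  [exists 2|exists 1|exists 2|exists 0|exists 1|exists 0];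
  by [left; split; apply/val_inj | right; split; apply/val_inj].
Qed.

Lemma Z3_prod (R : comRingType) (f : 'Z_3 -> R) (k : 'Z_3) :
  \prod_i f i = f (k - 1) * f k * f (k + 1).
Proof.
have -> : \prod_i f i = f 0 * f 1 * f 2.
  rewrite !big_ord_recl big_ord0 mulr1 mulrA.
  by congr (f _ * f _ * f _); apply/val_inj.
case: k => -[|[|[|//]]] hk.
- rewrite (_ : Ordinal hk = 0); last exact/val_inj.
  rewrite (_ : 0 - 1 = 2); last exact/val_inj.
  rewrite (_ : 0 + 1 = 1); last exact/val_inj.
  by ring.
- rewrite (_ : Ordinal hk = 1); last exact/val_inj.
  rewrite (_ : 1 - 1 = 0); last exact/val_inj.
  by rewrite (_ : 1 + 1 = 2); last exact/val_inj.
- rewrite (_ : Ordinal hk = 2); last exact/val_inj.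
  rewrite (_ : 2 - 1 = 1); last exact/val_inj.
  rewrite (_ : 2 + 1 = 0); last exact/val_inj.
  by ring.
Qed.

Lemma Z3_neq (k : 'Z_3) : k - 1 != k + 1.
Proof. by case: k => -[|[|[|//]]] hk. Qed.

End Z3.

(** * Square and deformation conditions for a single endomorphism *)

Section Main.
Context (R : realType) (n : nat) (M : manifold R n) (r : nat)
        (A : vbundle M r) (mu : lie_algebroid A) (gamma : lie_algebroid (dual A)).

Lemma double_endo_sqP (eps : R) (w : two_form A) (p : bivector A) :
  eps * eps = 1 ->
  (forall x, (double_endo eps w p x \o double_endo eps w p x)%VF = eps *: \1%VF) <->
  is_inverse p w.
Proof.
move=> eps2; have eps0 : eps != 0.
  by apply: contra_eq_neq eps2 => ->; rewrite mul0r eq_sym oner_neq0.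
split=> [sq x|/is_inverseP pw x]; last first.
  apply/lfunP => u; rewrite comp_lfunE scale_lfunE id_lfunE.
  by apply: double_endo2 => y; have [] := pw y.
(* Evaluation on (v, 0) isolates the block on [A], namely eps p(w v) = eps v. *)
apply/lfunP => v; have /lfunP/(_ (v, 0)) := sq x.
rewrite comp_lfunE scale_lfunE id_lfunE !double_endoE => -[/= h _].
by rewrite comp_lfunE id_lfunE; apply: (scalerI eps0).
Qed.

Lemma deform_double_endoP (eps : R) (w : two_form A) (p : bivector A) :
  eps * eps = 1 -> is_inverse p w ->
  eq_courant (deform (deform (double_courant mu gamma) (double_endo eps w p))
                (double_endo eps w p))
             (scale_courant eps (double_courant mu gamma)) <->
  (forall X Y Z, smooth_section X -> smooth_section Y -> smooth_section Z ->
     forall x, diff2 mu w X Y Z x = 0) /\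
  (forall a b c, smooth_section a -> smooth_section b -> smooth_section c ->
     forall x, diff2 gamma p a b c x = 0).
Proof.
move=> eps2 /is_inverseP pwp.
have pw x : cancel (flat w x) (sharp p x) by have [] := pwp x.
have wp x : cancel (sharp p x) (flat w x) by have [] := pwp x.
rewrite -!diff2_covector_eq0 -(torsion_eq0P mu gamma eps2 pw wp).
have SS := double_endo2 eps pw wp.
have d2 := deform2E (double_bilinear mu gamma)
                    (@smooth_section_double_endo _ _ _ _ _ eps w p) SS.
split=> [[_ eqd] e1 e2 s1 s2 x|t0].
  have := eqd _ _ s1 s2 x; rewrite d2 //= -[RHS]addr0 => /addrI/eqP.
  (* What vanishes is twice the torsion, and 2 is invertible in the reals. *)
  by rewrite -scaler_nat scaler_eq0 pnatr_eq0 => /eqP.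
split=> [x v f sf|e1 e2 s1 s2 x]; last by rewrite d2 // t0 // mul0rn addr0.
(* The twice deformed anchor is the anchor composed with S^2, hence [eps] times the anchor. *)
by rewrite /= SS /= !anchorZ // mulrDr.
Qed.

End Main.

(** * Commutation rules for the triplet *)

Section Anticommutation.
Context (R : realType) (n : nat) (M : manifold R n) (r : nat) (A : vbundle M r).
Context (eps : 'Z_3 -> R) (w : 'Z_3 -> two_form A) (p : 'Z_3 -> bivector A).
Context (eps2 : forall i, eps i * eps i = 1).
Context (pw : forall i x, cancel (flat (w i) x) (sharp (p i) x)).
Context (wp : forall i x, cancel (sharp (p i) x) (flat (w i) x)).

Local Notation S i x := (double_endo (eps i) (w i) (p i) x).

Definition recursion_comm k : Prop := forall x v,
  sharp (p (k - 1)) x (w (k + 1) x v) = eps k *: sharp (p (k + 1)) x (w (k - 1) x v).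

Lemma double_endo_comp i j x v a : S i x (S j x (v, a)) =
  (eps i *: sharp (p i) x (w j x v), eps j *: w i x (sharp (p j) x a)).
Proof. by rewrite !double_endoE /= linearZ. Qed.

(** Products of two of the endomorphisms are block diagonal. For the indices k-1 and k+1 the block
    on [A] gives the relation between the two recursion operators, where squares of signs cancel and
    leave the factor [eps k]; the block on the dual is its conjugate. *)
Lemma anticommuteP :
  (forall i j x, i != j ->
     (S i x \o S j x)%VF = (\prod_k eps k) *: (S j x \o S i x)%VF) <->
  (forall k, recursion_comm k).
Proof.
split=> [anti k x v|comm i j x ij].
  have /lfunP/(_ (v, 0)) h := anti _ _ x (Z3_neq k).
  rewrite scale_lfunE !comp_lfunE !double_endo_comp (Z3_prod _ k) in h.
  case: h => h _.
  move/(congr1 (fun u => eps (k - 1) *: u)): h.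
  rewrite !scalerA eps2 scale1r => ->; congr (_ *: _).
  have := eps2 (k - 1); have := eps2 (k + 1) => h1 h2.
  by ring: h1 h2.
have commD k a : w (k + 1) x (sharp (p (k - 1)) x a) =
    eps k *: w (k - 1) x (sharp (p (k + 1)) x a).
  by apply: recursion_dual; [exact: wp | exact: comm].
apply/lfunP => -[v a]; rewrite scale_lfunE !comp_lfunE !double_endo_comp.
have [k [[-> ->]|[-> ->]]] := Z3_pairs ij; rewrite (Z3_prod _ k) -[RHS]/(_ *: _, _ *: _);
  rewrite !commD !comm !scalerA;
  have := eps2 (k - 1); have := eps2 (k + 1); have := eps2 k => h1 h2 h3;
  congr (_ *: _, _ *: _); ring: h1 h2 h3.
Qed.

End Anticommutation.

Theorem theorem8p1 (R : realType) (n : nat) (M : manifold R n) (r : nat)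
    (A : vbundle M r) (mu : lie_algebroid A) (gamma : lie_algebroid (dual A))
    (bialg : lie_bialgebroid mu gamma)
    (eps : 'Z_3 -> R) (eps_sign : forall i, eps i = 1 \/ eps i = -1)
    (omega : 'Z_3 -> two_form A) (pi : 'Z_3 -> bivector A) :
  courant_hypersymplectic (@double_form R n M r A) (double_courant mu gamma) eps
    (fun i => double_endo (eps i) (omega i) (pi i))
  <->
  [/\ hypersymplectic mu eps omega,
      hypersymplectic gamma eps pi
    & forall i, is_inverse (pi i) (omega i)].
Proof.
have eps2 i : eps i * eps i = 1.
  by case: (eps_sign i) => ->; rewrite ?mulrNN mulr1.
split=> [[_ sq anti def]|[[sympw [q [qw Nq]]] [sympp _] inv]].
  have inv i : is_inverse (pi i) (omega i).
    by apply/(double_endo_sqP _ _ (eps2 i)) => x; exact: sq.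
  have pw i x : cancel (flat (omega i) x) (sharp (pi i) x).
    by have /is_inverseP/(_ x)[] := inv i.
  have wp i x : cancel (sharp (pi i) x) (flat (omega i) x).
    by have /is_inverseP/(_ x)[] := inv i.
  have /(anticommuteP eps2 wp) comm := anti.
  have closed i := (deform_double_endoP mu gamma (eps2 i) (inv i)).1 (def i).
  split=> //.
    split=> [i|].
      split; last by have [] := closed i.
      by move=> x; exact: nondegenerate_cancel (pw i x).
    (* The inverse bivectors required on [A] are the given ones. *)
    exists pi; split=> // i x /=; apply/lfunP => v.
    rewrite scale_lfunE id_lfunE comp_square_lfunE.
    by exact: (recursion_sqP _ (pw _ x) (wp _ x) (pw _ x) (wp _ x)).2 (comm i x) v.
  have pE i x a : pi i x a = ev A x (sharp (pi i) x a) by rewrite ev_sharp.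
  split=> [i|].
    split; last by have [] := closed i.
    move=> x; apply/lker0P => a b; rewrite !pE => /(congr1 (ev A x)^-1%VF).
    by rewrite !evK => /(can_inj (wp i x)).
  (* On the dual algebroid the inverses are the forms [omega i], transported to the bidual; N_i then
     becomes omega_(i-1) after pi_(i+1). *)
  exists (fun i => bidual_form (omega i)); split=> [i x|i x /=].
    apply/lfunP => a; rewrite comp_lfunE id_lfunE sharp_bidual pE evK; exact: wp.
  apply/lfunP => a; rewrite scale_lfunE id_lfunE comp_square_lfunE !sharp_bidual !pE !evK.
  apply: (recursion_sqP _ (wp _ x) (pw _ x) (wp _ x) (pw _ x)).2 a => {}a.
  (* The conjugated relation has the two sides exchanged; a second factor [eps i] restores the
     required order because its square is 1. *)
  have := recursion_dual (wp _ x) (comm i x) a => ->.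
  by rewrite scalerA eps2 scale1r.
have pw i x : cancel (flat (omega i) x) (sharp (pi i) x).
  by have /is_inverseP/(_ x)[] := inv i.
have wp i x : cancel (sharp (pi i) x) (flat (omega i) x).
  by have /is_inverseP/(_ x)[] := inv i.
(* The inverses [q] supplied by the structure on [A] agree with [pi] by uniqueness of inverses, so
   the conditions on N_i can be read in terms of [pi]. *)
have qE i x a : sharp (q i) x a = sharp (pi i) x a.
  by have /is_inverseP/(_ x)[qwi _] := qw i; rewrite -[in LHS](wp i x a) qwi.
split.
- by move=> i; split; [exact: double_endo_smooth | exact: double_endo_skew].
- by move=> i x; apply: (double_endo_sqP _ _ (eps2 i)).2; exact: inv.
- apply: (anticommuteP eps2 wp).2 => k x.
  apply/(recursion_sqP _ (pw _ x) (wp _ x) (pw _ x) (wp _ x)) => v.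
  have /lfunP/(_ v) := Nq k x.
  by rewrite scale_lfunE id_lfunE comp_square_lfunE !qE.
move=> i; apply/(deform_double_endoP mu gamma (eps2 i) (inv i)).
by split; [have [] := sympw i | have [] := sympp i].
Qed.
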